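(* Let $R$ be a commutative noetherian ring, $X=\operatorname{Spec} R$, and let $\Delta$ be a multiplicatively closed collection of ideals of $R$. For $H\in\Delta$ let $X_H=\operatorname{Proj}\bigl(\bigoplus_{k\in\mathbb N}H^k\bigr)\to X$ denote the corresponding blow-up. Then an element $f\in R$ belongs to Ratliff's $\Delta$-closure of an ideal $I\subseteq R$, i.e. $f\in I_\Delta$, if and only if for some $H\in\Delta$ the element $f$ belongs to the extended ideal of $I$ under $X_H\to X$.
   Context: Ratliff's $\Delta$-closure of an ideal $I$ is $I_\Delta=\bigcup_{H\in\Delta}(IH:H)$; thus $f\in I_\Delta$ iff there is $H\in\Delta$ with $fH\subseteq IH$. For a scheme morphism $Y\to\operatorname{Spec} R$, the extended ideal of $I$ is the ideal sheaf $I\mathcal O_Y$ given on every affine open subset $\operatorname{Spec} S\subseteq Y$ by $IS$; $f$ belongs to it if its pull-back lies in $\Gamma(Y,I\mathcal O_Y)$. *)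

(* Defs.v *)
(* Rings are taken in [comPzRingType] so that the zero ring, which occurs as a ring
   of sections, is included. *)
From HB Require Import structures.
From mathcomp Require Import all_boot all_order all_algebra generic_quotient.
From mathcomp Require Import all_classical.
From mathcomp Require Import topology.
From mathcomp Require Import ring.

Set Implicit Arguments.
Unset Strict Implicit.
Unset Printing Implicit Defensive.

Import GRing.Theory.
Local Open Scope classical_set_scope.
Local Open Scope ring_scope.

Section Ideals.
Variable A : comPzRingType.
Implicit Types I J H p G : set A.

(* The ideals of ring_quotient.v are boolean and proper; here the unit ideal
   must be allowed. *)
Definition is_ideal I : Prop :=
  [/\ I 0, forall x y, I x -> I y -> I (x + y) & forall a x, I x -> I (a * x)].

Definition prime_ideal p : Prop :=
  [/\ is_ideal p, ~ p 1 & forall a b, p (a * b) -> p a \/ p b].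

Definition idgen G : set A :=
  [set x | exists (n : nat) (a g : 'I_n -> A),
     (forall i, G (g i)) /\ x = \sum_(i < n) a i * g i].

Definition idmul I J : set A := idgen [set x * y | x in I & y in J].

Fixpoint idpow I (k : nat) : set A :=
  if k is k'.+1 then idmul I (idpow I k') else setT.

Definition idcolon I J : set A := [set x | forall y, J y -> I (x * y)].

Lemma idgen_sub G : G `<=` idgen G.
Proof.
move=> x Gx; exists 1%N, (fun=> 1), (fun=> x); split=> //.
by rewrite big_ord1 mul1r.
Qed.

Lemma idgen_ideal G : is_ideal (idgen G).
Proof.
split.
- by exists 0%N, (fun=> 0), (fun=> 0); split=> [[]//|]; rewrite big_ord0.
- move=> _ _ [m [a [g [Gg ->]]]] [n [b [h [Gh ->]]]].
  exists (m + n)%N, (fun i : 'I_(m + n) =>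
    match fintype.split i with inl j => a j | inr j => b j end).
  exists (fun i : 'I_(m + n) =>
    match fintype.split i with inl j => g j | inr j => h j end).
  split=> [i|]; first by case: (fintype.split i).
  rewrite big_split_ord /=; congr (_ + _); apply: eq_bigr => i _.
    by rewrite (unsplitK (inl i : 'I_m + 'I_n)%type).
  by rewrite (unsplitK (inr i : 'I_m + 'I_n)%type).
- move=> c _ [m [a [g [Gg ->]]]]; exists m, (fun i => c * a i), g; split=> //.
  by rewrite mulr_sumr; apply: eq_bigr => i _; rewrite mulrA.
Qed.

Lemma ideal_sum I n (F : 'I_n -> A) :
  is_ideal I -> (forall i, I (F i)) -> I (\sum_(i < n) F i).
Proof.
by move=> [I0 ID _] IF; elim/big_ind: _.
Qed.

Lemma idgen_min G I : is_ideal I -> G `<=` I -> idgen G `<=` I.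
Proof.
move=> idI GI _ [n [a [g [Gg ->]]]]; apply: ideal_sum => // i.
by case: idI => _ _; apply; apply: GI.
Qed.

Lemma idpow_ideal I k : is_ideal (idpow I k).
Proof. by case: k => [|k]; [split | exact: idgen_ideal]. Qed.

Lemma idpowM I j k a b :
  idpow I j a -> idpow I k b -> idpow I (j + k)%N (a * b).
Proof.
elim: j a b => [|j IHj] a b /=.
  by move=> _ kb; have [_ _ idM] := idpow_ideal I k; apply: idM.
move=> ja kb.
have [g0 gD gM] := idgen_ideal [set x * y | x in I & y in idpow I (j + k)%N].
suff : idgen [set x * y | x in I & y in idpow I j] `<=`
       [set a | idmul I (idpow I (j + k)%N) (a * b)] by apply.
apply: idgen_min => [|_ [x Ix [y jy <-]]] /=.
  split=> /=; first by rewrite mul0r.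
    by move=> x y; rewrite mulrDl; exact: gD.
  by move=> c x; rewrite -mulrA; exact: gM.
by apply: idgen_sub; exists x => //; exists (y * b); rewrite ?mulrA//; apply: IHj.
Qed.

End Ideals.

Definition noetherian (A : comPzRingType) : Prop :=
  forall J : set A, is_ideal J -> exists2 G, finite_set G & J = idgen G.

Definition mult_closed (A : comPzRingType) (Delta : set (set A)) : Prop :=
  forall H K, Delta H -> Delta K -> Delta (idmul H K).

Definition Delta_closure (A : comPzRingType) (Delta : set (set A)) (I : set A) :
  set A := \bigcup_(H in Delta) idcolon (idmul I H) H.

Record mulset (A : comPzRingType) := Mulset {
  mset :> A -> Prop;
  mset1 : mset 1;
  msetM : forall a b, mset a -> mset b -> mset (a * b) }.

Section Localization.
Variables (A : comPzRingType) (M : mulset A).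

Record frac_pair := FracPair { fnum : A; fden : A; _ : M fden }.
HB.instance Definition _ := gen_eqMixin frac_pair.
HB.instance Definition _ := gen_choiceMixin frac_pair.
Implicit Types x y z : frac_pair.

Lemma fdenP x : M (fden x). Proof. by case: x. Qed.

Definition frac_equiv x y : bool :=
  `[< exists2 u, M u & u * (fnum x * fden y) = u * (fnum y * fden x) >].

Lemma frac_equiv_refl : reflexive frac_equiv.
Proof. by move=> x; apply/asboolP; exists 1 => //; exact: mset1. Qed.

Lemma frac_equiv_sym : symmetric frac_equiv.
Proof. by move=> x y; apply/asboolP/asboolP => -[u Mu e]; exists u. Qed.

Lemma frac_equiv_trans : transitive frac_equiv.
Proof.
move=> y x z /asboolP[u Mu exy] /asboolP[v Mv eyz]; apply/asboolP.
exists (u * v * fden y); first by do !apply: msetM => //; exact: fdenP.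
transitivity (v * fden z * (u * (fnum x * fden y))); first by ring.
rewrite exy; transitivity (u * fden x * (v * (fnum y * fden z))); first by ring.
by rewrite eyz; ring.
Qed.

Canonical frac_equiv_rel :=
  EquivRel frac_equiv frac_equiv_refl frac_equiv_sym frac_equiv_trans.

Definition loc := {eq_quot frac_equiv}%qT.
HB.instance Definition _ : EqQuotient _ frac_equiv loc := EqQuotient.on loc.
HB.instance Definition _ := Choice.on loc.

Definition locpi x : loc := (\pi_loc x)%qT.

Definition mkfrac (a b : A) (Mb : M b) : loc := locpi (FracPair a Mb).

Lemma locpiP x y : locpi x = locpi y <->
  exists2 u, M u & u * (fnum x * fden y) = u * (fnum y * fden x).
Proof.
by split=> [/eqmodP/asboolP//|e]; apply/eqmodP; apply/asboolP.
Qed.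

Lemma locpiK (c : loc) : locpi (repr c) = c. Proof. exact: reprK. Qed.

Lemma locpi_repr x : exists2 u, M u &
  u * (fnum (repr (locpi x)) * fden x) = u * (fnum x * fden (repr (locpi x))).
Proof. by apply/locpiP; rewrite locpiK. Qed.

Lemma locW (P : loc -> Prop) : (forall x, P (locpi x)) -> forall c, P c.
Proof. by move=> h c; rewrite -(locpiK c). Qed.

Definition add_pair x y := FracPair (fnum x * fden y + fnum y * fden x)
  (msetM (fdenP x) (fdenP y)).
Definition opp_pair x := FracPair (- fnum x) (fdenP x).
Definition mul_pair x y := FracPair (fnum x * fnum y)
  (msetM (fdenP x) (fdenP y)).

Definition loc_add (c d : loc) : loc := locpi (add_pair (repr c) (repr d)).
Definition loc_opp (c : loc) : loc := locpi (opp_pair (repr c)).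
Definition loc_mul (c d : loc) : loc := locpi (mul_pair (repr c) (repr d)).
Definition loc_const (a : A) : loc := mkfrac a (mset1 M).

Lemma loc_addE x y : loc_add (locpi x) (locpi y) = locpi (add_pair x y).
Proof.
have [u Mu ex] := locpi_repr x; have [v Mv ey] := locpi_repr y.
apply/locpiP; exists (u * v); first exact: msetM.
move: (repr (locpi x)) (repr (locpi y)) ex ey => x' y' /= ex ey.
transitivity (v * fden y * fden y' * (u * (fnum x' * fden x))
   + u * fden x * fden x' * (v * (fnum y' * fden y))); first by ring.
by rewrite ex ey; ring.
Qed.

Lemma loc_oppE x : loc_opp (locpi x) = locpi (opp_pair x).
Proof.
have [u Mu ex] := locpi_repr x; apply/locpiP; exists u => //=.
by rewrite !mulNr !mulrN ex.
Qed.

Lemma loc_mulE x y : loc_mul (locpi x) (locpi y) = locpi (mul_pair x y).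
Proof.
have [u Mu ex] := locpi_repr x; have [v Mv ey] := locpi_repr y.
apply/locpiP; exists (u * v); first exact: msetM.
move: (repr (locpi x)) (repr (locpi y)) ex ey => x' y' /= ex ey.
transitivity ((u * (fnum x' * fden x)) * (v * (fnum y' * fden y))); first by ring.
by rewrite ex ey; ring.
Qed.

Let locE := (loc_addE, loc_oppE, loc_mulE).

Lemma locpi_eq x y : fnum x * fden y = fnum y * fden x -> locpi x = locpi y.
Proof. by move=> e; apply/locpiP; exists 1; [exact: mset1 | rewrite e]. Qed.

Lemma loc_addA : associative loc_add.
Proof.
elim/locW=> x; elim/locW=> y; elim/locW=> z; rewrite !locE.
by apply: locpi_eq => /=; ring.
Qed.
Lemma loc_addC : commutative loc_add.
Proof.
by elim/locW=> x; elim/locW=> y; rewrite !locE; apply: locpi_eq => /=; ring.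
Qed.
Lemma loc_add0 : left_id (loc_const 0) loc_add.
Proof. by elim/locW=> x; rewrite !locE; apply: locpi_eq => /=; ring. Qed.
Lemma loc_addN : left_inverse (loc_const 0) loc_opp loc_add.
Proof. by elim/locW=> x; rewrite !locE; apply: locpi_eq => /=; ring. Qed.
HB.instance Definition _ :=
  GRing.isZmodule.Build loc loc_addA loc_addC loc_add0 loc_addN.

Lemma loc_mulA : associative loc_mul.
Proof.
elim/locW=> x; elim/locW=> y; elim/locW=> z; rewrite !locE.
by apply: locpi_eq => /=; ring.
Qed.
Lemma loc_mulC : commutative loc_mul.
Proof.
by elim/locW=> x; elim/locW=> y; rewrite !locE; apply: locpi_eq => /=; ring.
Qed.
Lemma loc_mul1 : left_id (loc_const 1) loc_mul.
Proof. by elim/locW=> x; rewrite !locE; apply: locpi_eq => /=; ring. Qed.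
Lemma loc_mulDl : left_distributive loc_mul +%R.
Proof.
elim/locW=> x; elim/locW=> y; elim/locW=> z; rewrite /GRing.add /= !locE.
by apply: locpi_eq => /=; ring.
Qed.
HB.instance Definition _ :=
  GRing.Zmodule_isComPzRing.Build loc loc_mulA loc_mulC loc_mul1 loc_mulDl.

Lemma mkfracD a b c d (Mb : M b) (Md : M d) :
  mkfrac a Mb + mkfrac c Md = mkfrac (a * d + c * b) (msetM Mb Md).
Proof.
by rewrite [LHS](loc_addE (@FracPair a b Mb) (@FracPair c d Md)); apply: locpi_eq. Qed.
Lemma mkfracN a b (Mb : M b) : - mkfrac a Mb = mkfrac (- a) Mb.
Proof.
by rewrite [LHS](loc_oppE (@FracPair a b Mb)); apply: locpi_eq. Qed.
Lemma mkfracM a b c d (Mb : M b) (Md : M d) :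
  mkfrac a Mb * mkfrac c Md = mkfrac (a * c) (msetM Mb Md).
Proof.
by rewrite [LHS](loc_mulE (@FracPair a b Mb) (@FracPair c d Md)); apply: locpi_eq. Qed.
Lemma mkfrac_eq a b c d (Mb : M b) (Md : M d) :
  a * d = c * b -> mkfrac a Mb = mkfrac c Md.
Proof. exact: (@locpi_eq (FracPair a Mb) (FracPair c Md)). Qed.
Lemma mkfracW (P : loc -> Prop) :
  (forall a b (Mb : M b), P (mkfrac a Mb)) -> forall c, P c.
Proof. by move=> h; elim/locW=> -[a b Mb]; exact: h. Qed.

End Localization.

Section LocalizationMap.
Variables (A B : comPzRingType) (M : mulset A) (N : mulset B).
Variables (phi : {rmorphism A -> B}) (phiM : forall b, M b -> N (phi b)).

Definition loc_map (c : loc M) : loc N :=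
  mkfrac (phi (fnum (repr c))) (phiM (fdenP (repr c))).

Lemma loc_mapE a b (Mb : M b) : loc_map (mkfrac a Mb) = mkfrac (phi a) (phiM Mb).
Proof.
have [u Mu e] := locpi_repr (FracPair a Mb); apply/locpiP.
by exists (phi u); [exact: phiM | rewrite /= -!rmorphM /= e].
Qed.

Lemma loc_map_zmod : zmod_morphism loc_map.
Proof.
elim/mkfracW=> a b Mb; elim/mkfracW=> c d Md.
rewrite mkfracN mkfracD !loc_mapE mkfracN mkfracD.
by apply: mkfrac_eq; rewrite !rmorphD !rmorphM !rmorphN.
Qed.

Lemma loc_map_monoid : monoid_morphism loc_map.
Proof.
split; first by rewrite [LHS]loc_mapE; apply: mkfrac_eq; rewrite !rmorph1.
elim/mkfracW=> a b Mb; elim/mkfracW=> c d Md.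
by rewrite mkfracM !loc_mapE mkfracM; apply: mkfrac_eq; rewrite !rmorphM.
Qed.

HB.instance Definition _ :=
  GRing.isZmodMorphism.Build (loc M) (loc N) loc_map loc_map_zmod.
HB.instance Definition _ :=
  GRing.isMonoidMorphism.Build (loc M) (loc N) loc_map loc_map_monoid.

End LocalizationMap.

Definition dprod (T : Type) (O : T -> comPzRingType) := forall t, O t.

Section DependentProduct.
Variables (T : Type) (O : T -> comPzRingType).
HB.instance Definition _ := gen_eqMixin (dprod O).
HB.instance Definition _ := gen_choiceMixin (dprod O).
Implicit Types s : dprod O.

Let add s1 s2 : dprod O := fun t => s1 t + s2 t.
Let opp s : dprod O := fun t => - s t.
Let mul s1 s2 : dprod O := fun t => s1 t * s2 t.

Let addA : associative add.
Proof. by move=> ? ? ?; apply: functional_extensionality_dep => t; exact: addrA. Qed.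
Let addC : commutative add.
Proof. by move=> ? ?; apply: functional_extensionality_dep => t; exact: addrC. Qed.
Let add0 : left_id (fun=> 0) add.
Proof. by move=> ?; apply: functional_extensionality_dep => t; exact: add0r. Qed.
Let addN : left_inverse (fun=> 0) opp add.
Proof. by move=> ?; apply: functional_extensionality_dep => t; exact: addNr. Qed.
HB.instance Definition _ := GRing.isZmodule.Build (dprod O) addA addC add0 addN.

Let mulA : associative mul.
Proof. by move=> ? ? ?; apply: functional_extensionality_dep => t; exact: mulrA. Qed.
Let mulC : commutative mul.
Proof. by move=> ? ?; apply: functional_extensionality_dep => t; exact: mulrC. Qed.
Let mul1 : left_id (fun=> 1) mul.
Proof. by move=> ?; apply: functional_extensionality_dep => t; exact: mul1r. Qed.
Let mulDl : left_distributive mul +%R.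
Proof. by move=> ? ? ?; apply: functional_extensionality_dep => t; exact: mulrDl. Qed.
HB.instance Definition _ :=
  GRing.Zmodule_isComPzRing.Build (dprod O) mulA mulC mul1 mulDl.
End DependentProduct.

(* [sec X U] is the ring of sections over the open set U; its values at
   non-open sets are irrelevant. *)
Record ringedSpace := RingedSpace {
  rs_space :> topologicalType;
  sec : set rs_space -> comPzRingType;
  res : forall U V : set rs_space, V `<=` U -> {rmorphism sec U -> sec V};
  res_id : forall (U : set rs_space) (h : U `<=` U) s, res h s = s;
  res_comp : forall (U V W : set rs_space) (h : V `<=` U) (k : W `<=` V)
    (l : W `<=` U) s, res k (res h s) = res l s;
  rs_glue : forall (T : Type) (U : T -> set rs_space) (W : set rs_space)
    (UW : forall i, U i `<=` W) (s : forall i, sec (U i)),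
    (forall i, open (U i)) -> W `<=` \bigcup_i U i ->
    (forall i j, res (@subIsetl _ (U i) (U j)) (s i) =
                 res (@subIsetr _ (U i) (U j)) (s j)) ->
    exists! s0 : sec W, forall i, res (UW i) s0 = s i }.

Record rs_morphism (Y X : ringedSpace) := RsMorphism {
  mor_base :> Y -> X;
  mor_cont : continuous mor_base;
  mor_sharp : forall V : set X, {rmorphism sec V -> sec (mor_base @^-1` V)};
  mor_res : forall (U V : set X) (h : V `<=` U) (s : sec U),
    mor_sharp V (res h s) =
    res (@preimage_subset _ _ mor_base _ _ h) (mor_sharp U s) }.

(* For locally ringed spaces such a morphism is automatically local, being an
   isomorphism onto an open subspace. *)
Definition open_immersion (Y X : ringedSpace) (j : rs_morphism Y X) : Prop :=
  [/\ injective j, forall U : set Y, open U -> open (j @` U) &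
      forall V : set X, open V -> V `<=` range j -> bijective (mor_sharp j V)].

(* Common construction of Spec and Proj.  The points t of a [fracSpace] are given
   by prime ideals [fs_prime t] of a ring, with the Zariski topology.  Sections
   of the structure sheaf over U are families of germs that are locally given by
   one fraction a/b in [fs_frac]; the germs at t are taken in the localization at
   the elements of [fs_den] outside [fs_prime t].
   For Spec A, [fs_den] and [fs_frac] contain everything.  For Proj S, [fs_den]
   consists of the homogeneous elements and [fs_frac] of the pairs of homogeneous
   elements of the same degree, so that germs automatically lie in the degree-zero
   part of the localization. *)
Record fracSpace := FracSpace {
  fs_ring : comPzRingType;
  fs_pt : Type;
  fs_prime : fs_pt -> set fs_ring;
  fs_den : set fs_ring;
  fs_frac : set (fs_ring * fs_ring);
  fs_primeP : forall t, prime_ideal (fs_prime t);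
  fs_den1 : fs_den 1;
  fs_denM : forall a b, fs_den a -> fs_den b -> fs_den (a * b);
  fs_frac1 : fs_frac (1, 1);
  fs_fracB : forall a b c d, fs_frac (a, b) -> fs_frac (c, d) ->
    fs_frac (a * d - c * b, b * d);
  fs_fracM : forall a b c d, fs_frac (a, b) -> fs_frac (c, d) ->
    fs_frac (a * c, b * d) }.

Definition zariski (X : fracSpace) := fs_pt X.

Section Zariski.
Variable X : fracSpace.
HB.instance Definition _ := gen_eqMixin (zariski X).
HB.instance Definition _ := gen_choiceMixin (zariski X).

Definition zariski_open : set_system (zariski X) :=
  [set U | exists E : set (fs_ring X), U = [set t | ~ E `<=` fs_prime t]].

Let opT : zariski_open setT.
Proof.
exists setT; apply/seteqP; split=> // t _ /= /(_ 1 I).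
by case: (fs_primeP t).
Qed.

Let opI : setI_closed zariski_open.
Proof.
move=> _ _ [E ->] [F ->].
exists [set x * y | x in E & y in F]; apply/seteqP; split=> t /=.
- move=> [nE nF] EF; apply: nE => x Ex; apply: contrapT => nx; apply: nF => y Fy.
  have [_ _ /(_ x y)] := fs_primeP t; case=> //; apply: EF.
  by exists x => //; exists y.
- have [[_ _ pM] _ _] := fs_primeP t.
  move=> nEF; split=> sub; apply: nEF => _ [x Ex [y Fy <-]].
    by rewrite mulrC; apply: pM; exact: sub.
  by apply: pM; exact: sub.
Qed.

Let op_bigU (T : Type) (f : T -> set (zariski X)) :
  (forall i, zariski_open (f i)) -> zariski_open (\bigcup_i f i).
Proof.
move=> /choice[E fE]; exists (\bigcup_i E i); apply/seteqP; split=> t /=.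
- move=> [i _]; rewrite fE => nE sub; apply: nE => x Ex.
  by apply: sub; exists i.
- move=> nE; apply: contrapT => nt; apply: nE => x [i _ Eix].
  apply: contrapT => nx; apply: nt; exists i => //; rewrite fE => sub.
  exact: nx (sub _ Eix).
Qed.

HB.instance Definition _ :=
  isOpenTopological.Build (zariski X) opT opI op_bigU.

End Zariski.

Section StructureSheaf.
Variable X : fracSpace.
Local Notation T := (zariski X).

Program Definition fs_mulset (t : T) : mulset (fs_ring X) :=
  @Mulset _ [set b | fs_den b /\ ~ fs_prime t b] _ _.
Next Obligation. by move=> t; split; [exact: fs_den1 | case: (fs_primeP t)]. Qed.
Next Obligation.
move=> t a b [da na] [db nb]; split; first exact: fs_denM.
by have [_ _ pM] := fs_primeP t => /pM[].
Qed.

Definition fs_germ (t : T) : comPzRingType := loc (fs_mulset t).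

Definition fs_family (U : set T) := dprod (fun t : {t | U t} => fs_germ (sval t)).

Definition locally_fraction (U : set T) : pred (fs_family U) := fun s =>
  `[< forall t : T, U t -> exists V : set T, [/\ open V, V t & exists a b,
        fs_frac (a, b) /\ forall q : {t | U t}, V (sval q) ->
          exists mb : fs_mulset (sval q) b, s q = mkfrac a mb] >].

Record fs_sec (U : set T) := FsSec {
  fs_val : fs_family U;
  _ : locally_fraction fs_val }.

Section SectionRing.
Variable U : set T.
HB.instance Definition _ := [isSub for @fs_val U].
HB.instance Definition _ := [Choice of fs_sec U by <:].

Lemma locally_fraction_subring : subring_closed (@locally_fraction U).
Proof.
split.
- apply/asboolP => t Ut; exists setT; split=> //; first exact: openT.
  exists 1, 1; split; first exact: fs_frac1.
  by move=> q _; exists (mset1 _).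
- move=> s1 s2 /asboolP h1 /asboolP h2; apply/asboolP => t Ut.
  have [V1 [oV1 V1t [a [b [ab e1]]]]] := h1 t Ut.
  have [V2 [oV2 V2t [c [d [cd e2]]]]] := h2 t Ut.
  exists (V1 `&` V2); split=> //; first exact: openI.
  exists (a * d - c * b), (b * d); split; first exact: fs_fracB.
  move=> q [/e1[mb eb] /e2[md ed]]; exists (msetM mb md).
  by rewrite /GRing.add/= /GRing.opp/= eb ed mkfracN mkfracD mulNr.
- move=> s1 s2 /asboolP h1 /asboolP h2; apply/asboolP => t Ut.
  have [V1 [oV1 V1t [a [b [ab e1]]]]] := h1 t Ut.
  have [V2 [oV2 V2t [c [d [cd e2]]]]] := h2 t Ut.
  exists (V1 `&` V2); split=> //; first exact: openI.
  exists (a * c), (b * d); split; first exact: fs_fracM.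
  move=> q [/e1[mb eb] /e2[md ed]]; exists (msetM mb md).
  by rewrite /GRing.mul/= eb ed mkfracM.
Qed.

HB.instance Definition _ := GRing.SubChoice_isSubComPzRing.Build
  (fs_family U) (@locally_fraction U) (fs_sec U) locally_fraction_subring.
End SectionRing.

End StructureSheaf.

Section FracRingedSpace.
Variable X : fracSpace.
Local Notation T := (zariski X).
Implicit Types U V W : set T.

Definition fs_at U (s : fs_sec U) (t : T) (Ut : U t) : fs_germ t :=
  fs_val s (exist _ t Ut).

Lemma fs_atE U (s : fs_sec U) t (Ut Ut' : U t) : fs_at s Ut = fs_at s Ut'.
Proof. by rewrite (Prop_irrelevance Ut Ut'). Qed.

Lemma fs_sec_eq U (s s' : fs_sec U) :
  (forall t (Ut : U t), fs_at s Ut = fs_at s' Ut) -> s = s'.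
Proof.
by move=> e; apply: val_inj; apply: functional_extensionality_dep => -[t Ut]; exact: e.
Qed.

Lemma fs_secP U (s : fs_sec U) t : U t -> exists V : set T, [/\ open V, V t &
  exists a b, fs_frac (a, b) /\ forall q (Uq : U q), V q ->
    exists mb : fs_mulset q b, fs_at s Uq = mkfrac a mb].
Proof.
case: s => s s_lf /(elimT (asboolP _) s_lf t)[V [oV Vt [a [b [ab e]]]]].
exists V; split=> //; exists a, b; split=> // q Uq Vq.
exact: (e (exist _ q Uq) Vq).
Qed.

Section MkSec.
Variables (U : set T) (s : forall t, U t -> fs_germ t).
Hypothesis s_lf : forall t, U t -> exists V : set T, [/\ open V, V t &
  exists a b, fs_frac (a, b) /\ forall q (Uq : U q), V q ->
    exists mb : fs_mulset q b, s Uq = mkfrac a mb].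

Let family : fs_family U := fun q => s (proj2_sig q).
Let family_lf : locally_fraction family.
Proof.
apply/asboolP => t /s_lf[V [oV Vt [a [b [ab e]]]]].
by exists V; split=> //; exists a, b; split=> // -[q Uq] Vq; exact: e.
Qed.
Definition mk_sec : fs_sec U := FsSec family_lf.
Lemma mk_secE t (Ut : U t) : fs_at mk_sec Ut = s Ut.
Proof. by []. Qed.
End MkSec.

Section Restriction.
Variables (U V : set T) (h : V `<=` U).

Lemma fs_res_subproof (s : fs_sec U) t : V t -> exists W : set T, [/\ open W, W t &
  exists a b, fs_frac (a, b) /\ forall q (Vq : V q), W q ->
    exists mb : fs_mulset q b, fs_at s (h Vq) = mkfrac a mb].
Proof.
move=> Vt; have [W [oW Wt [a [b [ab e]]]]] := fs_secP s (h Vt).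
by exists W; split=> //; exists a, b; split=> // q Vq Wq; exact: e.
Qed.

Definition fs_res (s : fs_sec U) : fs_sec V := mk_sec (fs_res_subproof s).

Lemma fs_res_zmod : zmod_morphism fs_res.
Proof. by move=> s s'; apply: fs_sec_eq => t Vt; rewrite mk_secE. Qed.
Lemma fs_res_monoid : monoid_morphism fs_res.
Proof. by split=> [|s s']; apply: fs_sec_eq => t Vt; rewrite mk_secE. Qed.
HB.instance Definition _ :=
  GRing.isZmodMorphism.Build (fs_sec U) (fs_sec V) fs_res fs_res_zmod.
HB.instance Definition _ :=
  GRing.isMonoidMorphism.Build (fs_sec U) (fs_sec V) fs_res fs_res_monoid.
End Restriction.

Lemma fs_glue (I : Type) (U : I -> set T) W (UW : forall i, U i `<=` W)
    (s : forall i, fs_sec (U i)) :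
  (forall i, open (U i)) -> W `<=` \bigcup_i U i ->
  (forall i j, fs_res (@subIsetl _ (U i) (U j)) (s i) =
               fs_res (@subIsetr _ (U i) (U j)) (s j)) ->
  exists! s0 : fs_sec W, forall i, fs_res (UW i) s0 = s i.
Proof.
move=> oU WU s_eq.
have s_at i j t (Ui : U i t) (Uj : U j t) : fs_at (s i) Ui = fs_at (s j) Uj.
  have /(congr1 (fun z => @fs_at _ z t (conj Ui Uj))) := s_eq i j.
  by rewrite !mk_secE (fs_atE _ _ Ui) (fs_atE _ _ Uj).
have idx t (Wt : W t) : {i | U i t}.
  by apply: cid; have [i _ Ut] := WU t Wt; exists i.
pose f t (Wt : W t) : fs_germ t := fs_at (s (sval (idx t Wt))) (proj2_sig (idx t Wt)).
have f_lf t : W t -> exists V : set T, [/\ open V, V t &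
    exists a b, fs_frac (a, b) /\ forall q (Wq : W q), V q ->
    exists mb : fs_mulset q b, f q Wq = mkfrac a mb].
  move=> Wt; have [i _ Ut] := WU t Wt.
  have [V [oV Vt [a [b [ab e]]]]] := fs_secP (s i) Ut.
  exists (V `&` U i); split=> //; first by apply: openI.
  exists a, b; split=> // q Wq [Vq Uq].
  by rewrite /f (s_at _ i q _ Uq); exact: e.
exists (mk_sec f_lf); split=> [i|s1 s1E].
  by apply: fs_sec_eq => t Ut; rewrite !mk_secE; exact: s_at.
apply: fs_sec_eq => t Wt; rewrite mk_secE /f; case: (idx t Wt) => i Ut /=.
by rewrite -s1E mk_secE (Prop_irrelevance (UW i t Ut) Wt).
Qed.

Program Definition frac_space : ringedSpace :=
  @RingedSpace T (fun U => fs_sec U) (fun U V h => fs_res h) _ _ fs_glue.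
Next Obligation.
by move=> U h s; apply: fs_sec_eq => t Ut; rewrite [LHS]mk_secE; exact: fs_atE. Qed.
Next Obligation.
move=> U V W h k l s; apply: fs_sec_eq => t Wt.
rewrite [LHS]mk_secE [LHS]mk_secE [RHS]mk_secE;
  exact: fs_atE.
Qed.

End FracRingedSpace.

Section Spec.
Variable A : comPzRingType.

Program Definition spec_data : fracSpace :=
  @FracSpace A {p : set A | prime_ideal p} (fun t => sval t) setT setT
    _ _ _ _ _ _.
Next Obligation. by case. Qed.
Solve All Obligations with by [].

Definition Spec : ringedSpace := frac_space spec_data.

Lemma spec_const_subproof (U : set Spec) (a : A) (t : Spec) : U t ->
  exists V : set Spec, [/\ open V, V t & exists c b : A,
    fs_frac (f := spec_data) (c, b) /\ forall (q : Spec) (Uq : U q), V q ->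
      exists mb : fs_mulset q b,
        loc_const (fs_mulset (X := spec_data) q) a = mkfrac c mb].
Proof.
move=> Ut; exists setT; split=> //; first exact: openT.
by exists a, 1; split=> // q _ _; exists (mset1 _).
Qed.

Definition spec_const (U : set Spec) (a : A) : sec U :=
  mk_sec (fun t => spec_const_subproof a (t := t)).

End Spec.

Record gradedRing := GradedRing {
  gr_ring :> comPzRingType;
  gr_deg : nat -> set gr_ring;
  gr_degB : forall k a b, gr_deg k a -> gr_deg k b -> gr_deg k (a - b);
  gr_deg1 : gr_deg 0 1;
  gr_degM : forall j k a b, gr_deg j a -> gr_deg k b -> gr_deg (j + k) (a * b);
  gr_decomp : forall a, exists (n : nat) (c : nat -> gr_ring),
    (forall k, gr_deg k (c k)) /\ a = \sum_(k < n) c k;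
  gr_direct : forall (n : nat) (c : nat -> gr_ring),
    (forall k, gr_deg k (c k)) -> \sum_(k < n) c k = 0 ->
    forall k, (k < n)%N -> c k = 0 }.

Arguments gr_deg : clear implicits.

Section Proj.
Variable S : gradedRing.

Definition homogeneous : set S := \bigcup_k gr_deg S k.

Definition homogeneous_ideal (p : set S) : Prop :=
  is_ideal p /\ p = idgen (p `&` homogeneous).

Definition irrelevant : set S :=
  idgen (\bigcup_(k in [set k | (0 < k)%N]) gr_deg S k).

Definition is_proj_point (p : set S) : Prop :=
  [/\ prime_ideal p, homogeneous_ideal p & ~ irrelevant `<=` p].

Definition proj_frac : set (S * S) :=
  [set x | exists k, gr_deg S k x.1 /\ gr_deg S k x.2].

Program Definition proj_data : fracSpace :=
  @FracSpace S {p : set S | is_proj_point p} (fun t => sval t)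
    homogeneous proj_frac _ _ _ _ _ _.
Next Obligation. by case=> p []. Qed.
Next Obligation. by exists 0%N => //; exact: gr_deg1. Qed.
Next Obligation.
by move=> a b [j _ aj] [k _ bk]; exists (j + k)%N => //; exact: gr_degM.
Qed.
Next Obligation. by exists 0%N; split; exact: gr_deg1. Qed.
Next Obligation.
move=> a b c d [j [/= aj bj]] [k [/= ck dk]]; exists (j + k)%N; split=> /=.
  by apply: gr_degB; [|rewrite addnC]; exact: gr_degM.
exact: gr_degM.
Qed.
Next Obligation.
move=> a b c d [j [/= aj bj]] [k [/= ck dk]].
by exists (j + k)%N; split; exact: gr_degM.
Qed.

Definition Proj : ringedSpace := frac_space proj_data.

Section StructureMorphism.
Variables (A : comPzRingType) (phi : {rmorphism A -> S}).
Hypothesis phi_deg : forall a, gr_deg S 0 (phi a).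

Lemma proj_base_subproof (t : Proj) : prime_ideal (phi @^-1` sval t).
Proof.
case: t => p [[[p0 pD pM] p1 pP] _ _] /=; split.
- split=> [|x y|a x] /=; rewrite ?rmorph0 ?rmorphD ?rmorphM //; first exact: pD.
  exact: pM.
- by rewrite /= rmorph1.
- by move=> a b /=; rewrite rmorphM; exact: pP.
Qed.

Definition proj_base (t : Proj) : Spec A := exist _ _ (proj_base_subproof t).

Lemma proj_cont : continuous proj_base.
Proof.
apply/continuousP => _ [E ->]; exists (phi @` E); apply/seteqP; split=> t /= nE sub.
  by apply: nE => x Ex /=; apply: sub; exists x.
by apply: nE => _ [x Ex <-]; exact: sub.
Qed.

Lemma proj_phiM (t : Proj) b :
  fs_mulset (proj_base t) b -> fs_mulset t (phi b).
Proof. by case=> _ nb; split=> //; exists 0%N. Qed.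

Section Sharp.
Variable V : set (Spec A).

Lemma proj_sharp_subproof (s : fs_sec V) (t : Proj) : (proj_base @^-1` V) t ->
  exists W : set Proj, [/\ open W, W t & exists a b,
    fs_frac (f := proj_data) (a, b) /\
    forall (q : Proj) (Vq : (proj_base @^-1` V) q), W q ->
    exists mb : fs_mulset q b,
      loc_map (@proj_phiM q) (fs_at s Vq) = mkfrac a mb].
Proof.
move=> Vt; have [W [oW Wt [a [b [ab e]]]]] := fs_secP s Vt.
exists (proj_base @^-1` W); split=> //.
  by move/continuousP : proj_cont; apply.
exists (phi a), (phi b); split; first by exists 0%N; split; exact: phi_deg.
move=> q Vq Wq; have [mb {}e] := e (proj_base q) Vq Wq.
by exists (proj_phiM mb); rewrite e loc_mapE.
Qed.

Definition proj_sharp (s : fs_sec V) : fs_sec (X := proj_data) (proj_base @^-1` V) :=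
  mk_sec (fun t => @proj_sharp_subproof s t).

Lemma proj_sharp_zmod : zmod_morphism proj_sharp.
Proof.
by move=> s s'; apply: fs_sec_eq => t Vt; rewrite [LHS]mk_secE [LHS]rmorphB.
Qed.
Lemma proj_sharp_monoid : monoid_morphism proj_sharp.
Proof.
split=> [|s s']; apply: fs_sec_eq => t Vt; rewrite [LHS]mk_secE.
  exact: rmorph1.
exact: rmorphM.
Qed.
HB.instance Definition _ := GRing.isZmodMorphism.Build
  (fs_sec V) (fs_sec (X := proj_data) (proj_base @^-1` V)) proj_sharp proj_sharp_zmod.
HB.instance Definition _ := GRing.isMonoidMorphism.Build
  (fs_sec V) (fs_sec (X := proj_data) (proj_base @^-1` V)) proj_sharp proj_sharp_monoid.
End Sharp.

(* On points p |-> phi^-1(p), on germs a/b |-> phi(a)/phi(b). *)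
Program Definition proj_to_spec : rs_morphism Proj (Spec A) :=
  @RsMorphism Proj (Spec A) proj_base proj_cont (fun V => @proj_sharp V) _.
Next Obligation.
move=> U V h s; apply: fs_sec_eq => t Vt.
rewrite [LHS]mk_secE [RHS]mk_secE [RHS]mk_secE. 
by congr (loc_map _ _); rewrite [LHS]mk_secE; exact: fs_atE.
Qed.

End StructureMorphism.
End Proj.

Section Rees.
Variables (R : comPzRingType) (H : set R).

(* A sequence x represents the sum of the x_k t^k, with x_k in H^k; the product is
   the Cauchy product. *)
Record rees := Rees {
  rees_coef :> nat -> R;
  rees_coefP : forall k, idpow H k (rees_coef k);
  rees_fin : exists n, forall k, (n <= k)%N -> rees_coef k = 0 }.
HB.instance Definition _ := gen_eqMixin rees.
HB.instance Definition _ := gen_choiceMixin rees.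
Implicit Types x y z : rees.

Lemma rees_eq x y : (forall k, x k = y k) -> x = y.
Proof.
case: x y => [x xP xf] [y yP yf] /= /funext xy.
by subst y; congr Rees; exact: Prop_irrelevance.
Qed.

Program Definition rees_const (a : R) : rees :=
  @Rees (fun k => if k == 0%N then a else 0) _ _.
Next Obligation.
by move=> a [|k] //=; case: (idgen_ideal [set x * y | x in H & y in idpow H k]). Qed.
Next Obligation. by move=> a; exists 1%N => -[]. Qed.

Program Definition rees_add x y : rees := @Rees (fun k => x k + y k) _ _.
Next Obligation.
by move=> x y k; case: (idpow_ideal H k) => _ + _; apply; exact: rees_coefP.
Qed.
Next Obligation.
move=> x y; have [m xm] := rees_fin x; have [n yn] := rees_fin y.
by exists (m + n)%N => k hk; rewrite xm ?yn ?addr0//; apply: leq_trans hk;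
  rewrite ?leq_addr ?leq_addl.
Qed.

Program Definition rees_opp x : rees := @Rees (fun k => - x k) _ _.
Next Obligation.
move=> x k /=; rewrite -mulN1r.
by case: (idpow_ideal H k) => _ _; apply; exact: rees_coefP.
Qed.
Next Obligation.
by move=> x; have [m xm] := rees_fin x; exists m => k /xm ->; rewrite oppr0.
Qed.

Program Definition rees_mul x y : rees :=
  @Rees (fun k => \sum_(i < k.+1) x i * y (k - i)%N) _ _.
Next Obligation.
move=> x y k; apply: ideal_sum => [|i]; first exact: idpow_ideal.
have {1}-> : k = (i + (k - i))%N by rewrite subnKC// -ltnS.
by apply: idpowM; exact: rees_coefP.
Qed.
Next Obligation.
move=> x y; have [m xm] := rees_fin x; have [n yn] := rees_fin y.
exists (m + n)%N => k hk; apply: big1 => i _.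
have [mi|im] := leqP m i; first by rewrite xm ?mul0r.
rewrite yn ?mulr0// leq_subRL; last by rewrite -ltnS.
by apply: leq_trans hk; rewrite leq_add2r ltnW.
Qed.

Let addA : associative rees_add.
Proof. by move=> x y z; apply: rees_eq => k; exact: addrA. Qed.
Let addC : commutative rees_add.
Proof. by move=> x y; apply: rees_eq => k; exact: addrC. Qed.
Let add0 : left_id (rees_const 0) rees_add.
Proof. by move=> x; apply: rees_eq => k /=; case: ifP => _; exact: add0r. Qed.
Let addN : left_inverse (rees_const 0) rees_opp rees_add.
Proof. by move=> x; apply: rees_eq => k /=; case: ifP => _; exact: addNr. Qed.
HB.instance Definition _ := GRing.isZmodule.Build rees addA addC add0 addN.

Let mulC : commutative rees_mul.
Proof.
move=> x y; apply: rees_eq => k /=.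
rewrite (reindex_inj rev_ord_inj) /=; apply: eq_bigr => i _.
by rewrite mulrC subSS subKn // -ltnS.
Qed.
Let mulA : associative rees_mul.
Proof.
move=> x y z; apply: rees_eq => k /=.
rewrite [RHS](reindex_inj rev_ord_inj) /=.
pose c i j := x i * (y (k - i - j)%N * z j).
transitivity (\sum_(i < k.+1) \sum_(j < k.+1 | (j <= k - i)%N) c i j).
  apply: eq_bigr => i _; rewrite mulr_sumr (reindex_inj rev_ord_inj) /=.
  rewrite (big_ord_narrow_leq (leq_subr _ _)); apply: eq_bigr => j _ /=.
  by rewrite /c subSS subKn // -ltnS.
rewrite (exchange_big_dep predT) //=; apply: eq_bigr => j _.
have hj : (j <= k)%N by rewrite -ltnS.
rewrite (eq_bigl (fun i : 'I_k.+1 => (i <= k - j)%N)); last first.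
  by move=> i; rewrite !leq_subRL ?(addnC i) // -ltnS.
rewrite subSS mulr_suml (big_ord_narrow_leq (leq_subr _ _)).
by apply: eq_bigr => i _ /=; rewrite /c subKn // -!mulrA subnAC.
Qed.
Let mul1 : left_id (rees_const 1) rees_mul.
Proof.
move=> x; apply: rees_eq => k /=; rewrite big_ord_recl /= mul1r subn0.
by rewrite big1 ?addr0// => i _; rewrite mul0r.
Qed.
Let mulDl : left_distributive rees_mul +%R.
Proof.
move=> x y z; apply: rees_eq => k /=; rewrite -big_split /=.
by apply: eq_bigr => i _; rewrite mulrDl.
Qed.
HB.instance Definition _ :=
  GRing.Zmodule_isComPzRing.Build rees mulA mulC mul1 mulDl.

Definition rees_deg (k : nat) : set rees :=
  [set x | forall j, j != k -> x j = 0].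

Lemma rees_sumE n (c : nat -> rees) j :
  (\sum_(k < n) c k) j = \sum_(k < n) c k j.
Proof.
elim: n => [|n IHn]; first by rewrite !big_ord0 /=; case: ifP.
by rewrite !big_ord_recr /= -IHn.
Qed.

Program Definition rees_comp x (k : nat) : rees :=
  @Rees (fun j => if j == k then x k else 0) _ _.
Next Obligation.
move=> x k j /=; case: eqP => [->|_]; first exact: rees_coefP.
by case: (idpow_ideal H j).
Qed.
Next Obligation.
by move=> x k; exists k.+1 => j kj; rewrite gtn_eqF.
Qed.

Program Definition rees_graded : gradedRing := @GradedRing rees rees_deg _ _ _ _ _.
Next Obligation.
move=> k x y hx hy j jk.
by rewrite /= [LHS](congr2 +%R (hx j jk) (congr1 -%R (hy j jk))) subr0.
Qed.
Next Obligation. by case. Qed.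
Next Obligation.
move=> j k x y hx hy l ljk; apply: big1 => i _.
have [ij|ij] := eqVneq (i : nat) j; last by rewrite hx ?mul0r.
rewrite (hy (l - i)%N) ?mulr0//; apply: contraNN ljk => /eqP <-.
by rewrite -ij subnKC // -ltnS.
Qed.
Next Obligation.
move=> x; have [n xn] := rees_fin x; exists n, (rees_comp x); split.
  by move=> k j jk /=; rewrite (negbTE jk).
apply: rees_eq => j; rewrite rees_sumE /=.
have [jn|nj] := ltnP j n.
  rewrite (bigD1 (Ordinal jn)) //= eqxx big1 ?addr0 // => i ij.
  by rewrite eq_sym (negbTE (ij : (i : nat) != j)).
rewrite xn // big1 // => i _; rewrite gtn_eqF //.
exact: leq_trans (ltn_ord i) nj.
Qed.
Next Obligation.
move=> n c hc c0 k kn; apply: rees_eq => j.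
have [->|jk] := eqVneq j k; last by rewrite hc //= ; case: ifP.
have := congr1 (fun z : rees => z k) c0; rewrite rees_sumE /=.
rewrite (bigD1 (Ordinal kn)) //= big1 ?addr0 => [->|i ik]; first by case: ifP.
by rewrite hc // eq_sym.
Qed.

Lemma rees_const_zmod : zmod_morphism (rees_const : R -> rees_graded).
Proof.
by move=> a b; apply: rees_eq => k /=; case: ifP => // _; rewrite subr0.
Qed.
Lemma rees_const_monoid : monoid_morphism (rees_const : R -> rees_graded).
Proof.
split=> // a b; apply: rees_eq => -[|k] /=.
  by rewrite big_ord_recl big_ord0 addr0.
rewrite big_ord_recl /= mulr0 add0r big1 // => i _.
by rewrite mul0r.
Qed.
HB.instance Definition _ := GRing.isZmodMorphism.Build R rees_graded
  (rees_const : R -> rees_graded) rees_const_zmod.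
HB.instance Definition _ := GRing.isMonoidMorphism.Build R rees_graded
  (rees_const : R -> rees_graded) rees_const_monoid.

Lemma rees_const_deg a : gr_deg rees_graded 0 (rees_const a).
Proof. by case. Qed.

Definition blowup : ringedSpace := Proj rees_graded.

Definition blowup_mor : rs_morphism blowup (Spec R) :=
  @proj_to_spec rees_graded R rees_const rees_const_deg.

End Rees.

Definition affine_open (Y : ringedSpace) (U : set Y) : Prop :=
  exists (A : comPzRingType) (j : rs_morphism (Spec A) Y),
    open_immersion j /\ range j = U.

Section ExtendedIdeal.
Variables (R : comPzRingType) (Y : ringedSpace) (pi : rs_morphism Y (Spec R)).

Definition pullback (r : R) : sec [set: Y] :=
  mor_sharp pi setT (spec_const setT r).

(* Sections over V of the extended ideal sheaf: it is given by I Gamma(U, O_Y) on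
   the affine open sets U. *)
Definition ext_ideal (I : set R) (V : set Y) : set (sec V) :=
  [set s | forall (U : set Y) (UV : U `<=` V), affine_open U ->
     idgen [set res (@subsetT _ U) (pullback r) | r in I] (res UV s)].

Definition in_ext_ideal (I : set R) (f : R) : Prop :=
  ext_ideal I (pullback f).

End ExtendedIdeal.

(* Main.v *)
(* On the chart D+(gt) with g in H the blow-up is the spectrum of the subring R[H/g]
   of R_g, hence f lies in the extended ideal of I there if and only if
   f g^m is in I H^m for some m.  Since H is finitely generated, this for all g in H
   gives f H^m <= I H^m for large m, and H^m belongs to Delta when m > 0.
   Conversely, f g = sum a_i h_i with a_i in I and h_i in H yields
   f = sum a_i (h_i t)/(g t) on D+(gt), and membership in the extended ideal on an
   affine open set can be checked on a cover, even at the germs. *)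
Require Import Defs.
From HB Require Import structures.
From mathcomp Require Import all_boot all_algebra all_classical.
From mathcomp Require Import topology ring.

Set Implicit Arguments.
Unset Strict Implicit.
Unset Printing Implicit Defensive.

Import GRing.Theory.
Local Open Scope classical_set_scope.
Local Open Scope ring_scope.

(** Affine open sets are given by open immersions of spectra of arbitrary rings, and this shapes
    both directions. To use membership over D+(gt), an open immersion of Spec R[H/g] with that image
    must be built. To prove membership over an unknown affine open set, one needs that the global
    sections of Spec A are A and that ideal membership there is visible on germs. Both facts rest on
    one principle: an ideal contained in no prime contains 1. No degree-zero subring of a
    localization of the Rees algebra is constructed. Sending gt to 1 is a ring morphism defined on
    the whole Rees algebra, with image R[H/g]. The price is that elements of different degrees get
    identified, so they are repeatedly multiplied by powers of gt to reach a common degree. The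
    exponent m in f g^m has two sources: an element of I R[H/g] is x/g^k with x in I H^k, and
    equality of this fraction with f costs a further power of g. *)

Section Ideals.
Variable A : comPzRingType.
Implicit Types (I J H p G : set A) (M : mulset A).

(** * Ideals, primes and radicals *)

Lemma ideal0 I : is_ideal I -> I 0. Proof. by case. Qed.
Lemma idealD I x y : is_ideal I -> I x -> I y -> I (x + y).
Proof. by case=> _ ID _; exact: ID. Qed.
Lemma idealM I a x : is_ideal I -> I x -> I (a * x).
Proof. by case=> _ _ IM; exact: IM. Qed.
Lemma idealB I x y : is_ideal I -> I x -> I y -> I (x - y).
Proof. by move=> idI Ix Iy; apply: idealD => //; rewrite -mulN1r; exact: idealM. Qed.

Lemma prime_exp p x n : prime_ideal p -> p (x ^+ n) -> p x.
Proof.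
move=> [idp p1 pM]; elim: n => [|n IHn]; first by rewrite expr0.
by rewrite exprS => /pM[|/IHn].
Qed.

(** An ideal that is maximal among those containing [J] and disjoint from [M] is prime: if [a] and
    [b] lie outside [p], then p + (a) and p + (b) both meet [M], and the product of the two common
    elements lies in p + (ab). *)
Lemma prime_avoiding J M : is_ideal J -> (forall x, J x -> ~ M x) ->
  exists p, [/\ prime_ideal p, J `<=` p & forall x, p x -> ~ M x].
Proof.
move=> idJ JM; pose good p := [/\ is_ideal p, J `<=` p & forall x, p x -> ~ M x].
have [F Fgood Ftot|p [pgood pmax]] := @Zorn_bigcup A [set p | p = set0 \/ good p].
  have [[q0 [Fq0 q00]]|F0] := pselect (exists q, F q /\ q !=set0); last first.
    left; apply/seteqP; split=> // x [q Fq qx].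
    by apply: F0; exists q; split=> //; exists x.
  have gq q x : F q -> q x -> good q.
    by move=> Fq qx; have [q_0|//] := Fgood q Fq; rewrite q_0 in qx.
  right; have [x0 q0x0] := q00; have [id0 J0 M0] := gq _ _ Fq0 q0x0; split.
  - split; first by exists q0 => //; exact: ideal0.
      move=> x y [q Fq qx] [r Fr ry].
      have [idq _ _] := gq _ _ Fq qx; have [idr _ _] := gq _ _ Fr ry.
      by have [/(_ _ qx) rx|/(_ _ ry) qy] := Ftot q r Fq Fr;
        [exists r | exists q] => //; exact: idealD.
    move=> a x [q Fq qx]; have [idq _ _] := gq _ _ Fq qx.
    by exists q => //; exact: idealM.
  - by move=> x /J0; exists q0.
  - by move=> x [q Fq qx]; have [_ _] := gq _ _ Fq qx; exact.
have {pgood} [p0|[idp Jp pM]] := pgood.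
  case: (pmax J); last by right; split.
  by rewrite p0; split=> // /(_ 0) /(_ (ideal0 idJ)).
exists p; split=> //; split=> //; first by move=> /pM; apply; exact: mset1.
move=> a b pab; apply: contrapT => /not_orP[pa pb].
have meet c : ~ p c -> exists2 x, M x & exists r, p (x - r * c).
  move=> pc; pose pcI := [set x | exists r, p (x - r * c)].
  have idpc : is_ideal pcI.
    split; first by exists 0; rewrite mul0r subr0; exact: ideal0.
      move=> x y [r pr] [s ps]; exists (r + s).
      have -> : x + y - (r + s) * c = (x - r * c) + (y - s * c) by ring.
      exact: idealD.
    move=> d x [r pr]; exists (d * r).
    have -> : d * x - d * r * c = d * (x - r * c) by ring.
    exact: idealM.
  have ppc : p `<=` pcI by move=> x px; exists 0; rewrite mul0r subr0.
  apply: contrapT => nM; apply: (pmax pcI).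
    split=> // sub; apply: pc; apply: sub; exists 1; rewrite mul1r subrr; exact: ideal0.
  right; split=> //; first exact: subset_trans ppc.
  by move=> x [r pr] Mx; apply: nM; exists x => //; exists r.
have [x Mx [r pr]] := meet a pa; have [y My [s ps]] := meet b pb.
apply: (pM (x * y)); last exact: msetM.
have -> : x * y = y * (x - r * a) + r * a * (y - s * b) + r * s * (a * b) by ring.
by do !apply: idealD => //; apply: idealM.
Qed.

Program Definition mulset_one : mulset A := @Mulset A [set 1] _ _.
Next Obligation. by []. Qed.
Next Obligation. by move=> _ _ -> ->; rewrite mulr1. Qed.

Program Definition powers (h : A) : mulset A :=
  @Mulset A [set x | exists n, x = h ^+ n] _ _.
Next Obligation. by move=> h; exists 0%N; rewrite expr0. Qed.
Next Obligation.
by move=> h _ _ [m ->] [n ->]; exists (m + n)%N; rewrite exprD.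
Qed.

(** Avoiding {1} means being proper. This is the local-to-global device of the proof: the
    multipliers that achieve a property form an ideal, and local solvability shows that no prime
    contains it. *)
Lemma ideal_top J : is_ideal J ->
  (forall p, prime_ideal p -> ~ J `<=` p) -> J 1.
Proof.
move=> idJ nJ; apply: contrapT => J1.
have [|p [pp Jp _]] := @prime_avoiding J mulset_one idJ; last exact: nJ Jp.
by move=> x Jx x1; apply: J1; rewrite -(x1 : x = 1).
Qed.

Lemma ideal_radical J h : is_ideal J ->
  (forall p, prime_ideal p -> J `<=` p -> p h) -> exists n, J (h ^+ n).
Proof.
move=> idJ Jh; apply: contrapT => nJ.
have [|p [pp Jp pM]] := @prime_avoiding J (powers h) idJ.
  by move=> x Jx [n xE]; apply: nJ; exists n; rewrite -xE.
by apply: (pM h); [exact: Jh | exists 1%N; rewrite expr1].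
Qed.

End Ideals.

Lemma idgen_image (A B : comPzRingType) (phi : {rmorphism A -> B}) (G : set A)
  (G' : set B) x : (forall y, G y -> idgen G' (phi y)) -> idgen G x -> idgen G' (phi x).
Proof.
move=> GG'; have idG' := idgen_ideal G'.
suff : idgen G `<=` phi @^-1` idgen G' by apply.
apply: idgen_min => //; split=> /= [|y z|a y].
- by rewrite rmorph0; exact: ideal0.
- by rewrite rmorphD; exact: idealD.
- by rewrite rmorphM; exact: idealM.
Qed.

Section Germs.
Variable X : fracSpace.
Variables (U : set (zariski X)) (t : zariski X) (Ut : U t).

Definition germ (s : fs_sec U) : fs_germ t := fs_at s Ut.

Lemma germ_zmod : zmod_morphism germ. Proof. by []. Qed.
Lemma germ_monoid : monoid_morphism germ. Proof. by []. Qed.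
HB.instance Definition _ := GRing.isZmodMorphism.Build _ _ germ germ_zmod.
HB.instance Definition _ := GRing.isMonoidMorphism.Build _ _ germ germ_monoid.

Lemma fs_at0 : fs_at (0 : fs_sec U) Ut = 0. Proof. by []. Qed.
Lemma fs_atD (s s' : fs_sec U) : fs_at (s + s') Ut = fs_at s Ut + fs_at s' Ut.
Proof. by []. Qed.
Lemma fs_atM (s s' : fs_sec U) : fs_at (s * s') Ut = fs_at s Ut * fs_at s' Ut.
Proof. by []. Qed.
End Germs.

Lemma mkfracP (A : comPzRingType) (M : mulset A) a b c d (Mb : M b) (Md : M d) :
  mkfrac a Mb = mkfrac c Md <-> exists2 u, M u & u * (a * d) = u * (c * b).
Proof. exact: (locpiP (FracPair a Mb) (FracPair c Md)). Qed.

(** * Global sections of Spec A and ideals in them *)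

Section SpecSections.
Variables (A : comPzRingType) (W : set (Spec A)).
Implicit Types (a b : A) (s : fs_sec (X := spec_data A) W).

Lemma spec_mulset (t : Spec A) b :
  ~ sval t b -> fs_mulset (X := spec_data A) t b.
Proof. by []. Qed.

Lemma spec_mulsetN (t : Spec A) b :
  fs_mulset (X := spec_data A) t b -> ~ sval t b.
Proof. by case. Qed.

Definition spec_consts a : fs_sec (X := spec_data A) W := spec_const W a.

Lemma spec_constsE a (t : Spec A) (Wt : W t) :
  fs_at (spec_consts a) Wt = mkfrac a (mset1 _).
Proof. by []. Qed.

Lemma spec_consts_zmod : zmod_morphism spec_consts.
Proof.
move=> a b; apply: fs_sec_eq => t Wt; rewrite [RHS](germ_zmod Wt) /germ !spec_constsE.
by rewrite mkfracN mkfracD; apply: mkfrac_eq; ring.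
Qed.

Lemma spec_consts_monoid : monoid_morphism spec_consts.
Proof.
split=> [|a b]; apply: fs_sec_eq => t Wt //.
have -> : fs_at (spec_consts a * spec_consts b) Wt =
  fs_at (spec_consts a) Wt * fs_at (spec_consts b) Wt by [].
by rewrite !spec_constsE mkfracM; apply: mkfrac_eq; ring.
Qed.

HB.instance Definition _ := GRing.isZmodMorphism.Build A _ spec_consts spec_consts_zmod.
HB.instance Definition _ := GRing.isMonoidMorphism.Build A _ spec_consts spec_consts_monoid.

Hypothesis Wfull : forall t, W t.

Lemma spec_consts_inj : injective spec_consts.
Proof.
move=> a b ab; pose J := [set x | x * a = x * b].
suff : J 1 by rewrite /J /= !mul1r.
apply: ideal_top => [|p pp Jp].
  split=> [|x y|c x]; rewrite /J /=; first by rewrite !mul0r.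
    by rewrite !mulrDl => -> ->.
  by rewrite -!mulrA => ->.
pose t : Spec A := exist _ p pp.
have := congr1 (fun s => fs_at s (Wfull t)) ab; rewrite !spec_constsE.
case/mkfracP => u /spec_mulsetN; rewrite !mulr1 => pu uab.
exact/pu/Jp.
Qed.

Let frac_on s (a b : A) := forall (q : Spec A) (Wq : W q), ~ sval q b ->
  exists mb : fs_mulset (X := spec_data A) q b, fs_at s Wq = mkfrac a mb.

Let frac_near s (t : Spec A) : exists a b, ~ sval t b /\ frac_on s a b.
Proof.
have [V [[E ->] nE [a [b [_ sab]]]]] := fs_secP s (Wfull t).
have [/= mb _] := sab t (Wfull t) nE.
have [h Eh nh] : exists2 h, E h & ~ sval t h.
  apply: contrapT => nh; apply: nE => x Ex; apply: contrapT => nx.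
  by apply: nh; exists x.
(* D(h) is inside the given neighbourhood as [h] is in [E], so after this change the fraction is
   valid on all of D(bh). *)
exists (a * h), (b * h); split.
  by have [_ _ pM] := svalP t => /pM[|//]; exact: spec_mulsetN.
move=> q Wq nbh; have [[_ _ qM] _ _] := svalP q.
have [|{}mb ->] := sab q Wq.
  by move=> /(_ _ Eh) qh; apply: nbh; exact: qM.
by exists (spec_mulset nbh); apply: mkfrac_eq; ring.
Qed.

(** Finitely many denominators generate the unit ideal. The fractions are glued after multiplication
    by a common power of the denominators, which absorbs the multipliers hidden in equality of
    fractions. *)
Lemma spec_consts_surj s : exists a, s = spec_consts a.
Proof.
pose E := [set b | exists a, frac_on s a b].
have [n [e [b [Eb e1]]]] : idgen E 1.
  apply: ideal_top => [|p pp Ep]; first exact: idgen_ideal.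
  have [a [b [nb sab]]] := frac_near s (exist _ p pp).
  by apply/nb/Ep/idgen_sub; exists a.
have cover p : prime_ideal p -> exists i, ~ p (b i).
  move=> [idp p1 _]; apply: contrapT => nb; apply: p1; rewrite e1.
  apply: ideal_sum => // i; apply: idealM => //.
  by apply: contrapT => pb; apply: nb; exists i.
have [a sab] : exists a : 'I_n -> A, forall i, frac_on s (a i) (b i).
  by have [a ?] := choice Eb; exists a.
have /choice[N' N'E] (ij : 'I_n * 'I_n) : exists m,
    (b ij.1 * b ij.2) ^+ m * (a ij.1 * b ij.2) =
    (b ij.1 * b ij.2) ^+ m * (a ij.2 * b ij.1).
  (* [J] annihilates the difference of the cross products. The two fractions agree at each prime of
     D(b_i b_j), so every prime containing [J] contains b_i b_j. *)
  case: ij => i j /=; set J := fun x => x * (a i * b j) = x * (a j * b i).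
  apply: (@ideal_radical _ J) => [|p pp Jp].
    split=> [|x y|c x]; rewrite /J /=; first by rewrite !mul0r.
      by rewrite !mulrDl => -> ->.
    by rewrite -!mulrA => ->.
  apply: contrapT => nb; have [[_ _ pM] _ _] := pp; pose q : Spec A := exist _ p pp.
  have nbi : ~ sval q (b i) by move=> pb; apply: nb; rewrite mulrC; exact: pM.
  have nbj : ~ sval q (b j) by move=> pb; apply: nb; exact: pM.
  have [mi si] := sab i q (Wfull q) nbi; have [mj] := sab j q (Wfull q) nbj.
  by rewrite si => /mkfracP[u /spec_mulsetN nu uij]; apply/nu/Jp.
pose N := (\sum_ij N' ij)%N.
have NE i j : (b i * b j) ^+ N * (a i * b j) = (b i * b j) ^+ N * (a j * b i).
  have le : (N' (i, j) <= N)%N by rewrite /N (bigD1 (i, j)) //= leq_addr.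
  by rewrite -(subnK le) exprD -!mulrA (N'E (i, j)).
(* This replaces a partition of unity: the ideal of all [y] admitting such an [a0] contains each
   [b i ^+ N.+1], with [a0 := a i * b i ^+ N], and the [b i] have no common prime. *)
have [a0 a0E] : exists a0, forall j, a0 * b j ^+ N.+1 = a j * b j ^+ N * 1.
  pose J := [set y | exists a0, forall j, a0 * b j ^+ N.+1 = a j * b j ^+ N * y].
  suff : J 1 by [].
  apply: ideal_top => [|p pp Jp].
    split=> [|x y [c cE] [d dE]|x y [c cE]].
    - by exists 0 => j; rewrite mul0r mulr0.
    - by exists (c + d) => j; rewrite mulrDl cE dE mulrDr.
    - by exists (x * c) => j; rewrite -mulrA cE; ring.
  have [i] := cover p pp; apply; apply: (@prime_exp _ _ _ N.+1) => //; apply: Jp.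
  exists (a i * b i ^+ N) => j.
  transitivity ((b i * b j) ^+ N * (a i * b j)).
    by rewrite exprMn exprS; ring.
  by rewrite NE exprMn exprS; ring.
exists a0; apply: fs_sec_eq => q Wq; rewrite spec_constsE.
have [i nbi] := cover _ (svalP q); have [mb ->] := sab i q Wq nbi.
apply/mkfracP; exists (b i ^+ N).
  by apply: spec_mulset => /prime_exp bi; apply/nbi/bi/svalP.
by rewrite mulrCA mulr1 -[LHS]mulr1 -a0E exprSr; ring.
Qed.

(** The ideal [K] of multipliers carrying [s] into [idgen G] lies in no prime: at [p], writing the
    germ of [s] as a fraction with numerator in [idgen G] yields a multiplier outside [p]. *)
Lemma spec_idgen_local s (G : set (fs_sec (X := spec_data A) W)) :
  (forall t (Wt : W t), idgen [set fs_at g Wt | g in G] (fs_at s Wt)) -> idgen G s.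
Proof.
move=> sG; have idG := idgen_ideal G.
pose K := [set x | idgen G (spec_consts x * s)].
suff : K 1 by rewrite /K /= rmorph1 mul1r.
apply: ideal_top => [|p pp Kp].
  split=> [|x y|c x]; rewrite /K /=; first by rewrite rmorph0 mul0r; exact: ideal0.
    by rewrite rmorphD mulrDl; exact: idealD.
  by rewrite rmorphM -mulrA; exact: idealM.
have [_ p1 pM] := pp; pose t : Spec A := exist _ p pp.
(* [D] is the localization at [t] of the constants lying in [idgen G]. It contains the germ of each
   [g] in [G], since [g] is itself a constant. *)
pose D : set (fs_germ t) := [set z | exists a w,
  [/\ idgen G (spec_consts a), ~ p w & mkfrac w (mset1 _) * z = mkfrac a (mset1 _)]].
have idD : is_ideal D.
  split=> [|x y [a [v [Ga nv e]]] [b [w [Gb nw e']]]|z x [a [v [Ga nv e]]]].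
  - exists 0, 1; rewrite rmorph0 mulr0; split=> //; exact: ideal0.
  - exists (w * a + v * b), (v * w); split.
    + rewrite rmorphD !rmorphM; apply: idealD => //; exact: idealM.
    + by move=> /pM[].
    + have -> : mkfrac (v * w) (mset1 (fs_mulset (X := spec_data A) t)) =
        mkfrac v (mset1 _) * mkfrac w (mset1 _).
        by rewrite mkfracM; apply: mkfrac_eq; ring.
      have comb (p' q' : fs_germ t) : p' * q' * (x + y) = q' * (p' * x) + p' * (q' * y).
        by ring.
      rewrite comb e e'.
      by rewrite !mkfracM mkfracD; apply: mkfrac_eq; ring.
  - elim/mkfracW: z => c d md; have nd := spec_mulsetN md.
    exists (c * a), (d * v); split.
    + by rewrite rmorphM; exact: idealM.
    + by move=> /pM[].
    + have -> : mkfrac (d * v) (mset1 (fs_mulset (X := spec_data A) t)) =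
        mkfrac d (mset1 _) * mkfrac v (mset1 _).
        by rewrite mkfracM; apply: mkfrac_eq; ring.
      rewrite mulrACA e [X in X * _]mkfracM mkfracM; apply: mkfrac_eq; ring.
have : D (fs_at s (Wfull t)).
  suff : idgen [set fs_at g (Wfull t) | g in G] `<=` D by apply.
  apply: idgen_min => // _ [g Gg <-]; have [a gE] := spec_consts_surj g.
  exists a, 1; rewrite -gE; split; first exact: idgen_sub.
    exact: p1.
  by rewrite gE; exact: mul1r.
have [c sE] := spec_consts_surj s.
move=> [a [w [Ga nw]]]; rewrite sE spec_constsE mkfracM.
case/mkfracP=> u /spec_mulsetN nu; rewrite !mulr1 => uwc.
have : K (u * w) by rewrite /K /= sE -rmorphM -mulrA uwc rmorphM; exact: idealM.
by move=> /Kp /pM[].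
Qed.

End SpecSections.

(** * Powers of finitely generated ideals *)

Section IdealPowers.
Variable A : comPzRingType.
Implicit Types (I J H L G : set A).

Lemma ideal_shift J c : is_ideal J -> is_ideal [set w | J (c * w)].
Proof.
move=> idJ; split=> [|x y|a x] /=; first by rewrite mulr0; exact: ideal0.
  by rewrite mulrDr; exact: idealD.
by rewrite mulrCA; exact: idealM.
Qed.

Lemma idmul_setT H : is_ideal H -> idmul H setT = H.
Proof.
move=> idH; apply/seteqP; split=> [|x Hx].
  by apply: idgen_min => // _ [x Hx [y _ <-]]; rewrite mulrC; exact: idealM.
by apply: idgen_sub; exists x => //; exists 1; rewrite ?mulr1.
Qed.

Lemma idmul_sub I J x y : I x -> J y -> idmul I J (x * y).
Proof. by move=> Ix Jy; apply: idgen_sub; exists x => //; exists y. Qed.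

Lemma idpow_mono L H k : L `<=` H -> idpow L k `<=` idpow H k.
Proof.
move=> LH; elim: k => //= k IHk; apply: idgen_min => [|_ [x Lx [y ky <-]]].
  exact: idgen_ideal.
by apply: idmul_sub; [exact: LH | exact: IHk].
Qed.

Lemma idpow_exp H k x : H x -> idpow H k (x ^+ k).
Proof. by move=> Hx; elim: k => //= k IHk; rewrite exprS; exact: idmul_sub. Qed.

Lemma idmul_idpowM I H j k x y : idmul I (idpow H j) x -> idpow H k y ->
  idmul I (idpow H (j + k)%N) (x * y).
Proof.
move=> + ky; rewrite mulrC; have idT := idgen_ideal [set x * y | x in I & y in idpow H (j + k)%N].
suff : idmul I (idpow H j) `<=` [set x | idmul I (idpow H (j + k)%N) (y * x)] by apply.
apply: idgen_min => [|_ [a Ia [b jb <-]]]; first exact: ideal_shift.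
by rewrite /= mulrCA (mulrC y); apply: idmul_sub => //; exact: idpowM.
Qed.

(* A long product of generators contains a high power of one of them; [u ^+ i * v * w]
   records the factors already sorted out, those equal to the head [g] of the list
   and those in the ideal of its tail. *)
Lemma idpow_generated I H f (gs : seq A) : is_ideal H ->
  (forall g, g \in gs -> H g /\ exists m, idmul I (idpow H m) (f * g ^+ m)) ->
  exists m, forall N, (m <= N)%N -> forall x, idpow (idgen [set` gs]) N x ->
    idmul I (idpow H N) (f * x).
Proof.
move=> idH; elim: gs => [_|g gs IHgs gsP].
  (* Without generators the ideal is zero, but its power 0 is the unit ideal; hence the bound 1. *)
  exists 1%N => -[//|N] _ x xN; suff -> : x = 0.
    by rewrite mulr0; apply: ideal0; exact: idgen_ideal.
  have id0 : is_ideal [set 0 : A].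
    by split=> // [_ _ -> ->|a _ ->]; rewrite ?addr0 ?mulr0.
  suff : idpow (idgen [set` [::]]) N.+1 `<=` [set 0 : A] by apply.
  apply: idgen_min => // _ [y y0 [z _ <-]].
  have -> : y = 0 by apply: (idgen_min id0 _ y0) => ? /=.
  by rewrite mul0r.
have [Hg [m1 gm1]] := gsP g (mem_head _ _).
have [h hgs|m2 gsm2] := IHgs; first by apply: gsP; rewrite inE hgs orbT.
set L := idgen [set` g :: gs]; set L' := idgen [set` gs] in gsm2.
(* Once all factors are sorted, i + j >= m1 + m2 forces i >= m1, where the hypothesis on [g]
   applies, or j >= m2, where the induction hypothesis does. *)
exists (m1 + m2)%N => N mN x Nx.
suff sorted k i j v w : idpow L' j v -> idpow L k w -> (m1 + m2 <= i + j + k)%N ->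
    idmul I (idpow H (i + j + k)%N) (f * (g ^+ i * v * w)).
  by have := sorted N 0%N 0%N 1 x; rewrite expr0 !mul1r; apply.
have L'H : L' `<=` H.
  by apply: idgen_min => // h hgs; have [] := gsP h; rewrite // inE hgs orbT.
elim: k i j v w => [|k IHk] i j v w jv.
  move=> _; rewrite addn0 => mij; have [m1i|im1] := leqP m1 i.
    have -> : f * (g ^+ i * v * w) = f * g ^+ m1 * (g ^+ (i - m1) * v * w).
      by rewrite -{1}(subnKC m1i) exprD; ring.
    rewrite -(subnKC m1i) -addnA; apply: idmul_idpowM => //.
    rewrite mulrC; apply: idealM; first exact: idpow_ideal.
    by rewrite subnKC //; apply: idpowM; [exact: idpow_exp | exact: idpow_mono jv].
  have m2j : (m2 <= j)%N.
    by rewrite -(leq_add2l m1); apply: leq_trans mij _; rewrite leq_add2r ltnW.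
  have -> : f * (g ^+ i * v * w) = f * v * (w * g ^+ i) by ring.
  rewrite addnC; apply: idmul_idpowM; first exact: gsm2.
  by apply: idealM; [exact: idpow_ideal | exact: idpow_exp].
move=> kw mij; pose T := [set w | idmul I (idpow H (i + j + k.+1)) (f * (g ^+ i * v) * w)].
have idT : is_ideal T by exact/ideal_shift/idgen_ideal.
rewrite mulrA; suff : idmul L (idpow L k) `<=` T by apply.
apply: idgen_min => // _ [z Lz [y ky <-]]; rewrite mulrC.
suff : L `<=` [set z | T (y * z)] by apply.
apply: idgen_min => [|h /=]; first exact: ideal_shift.
rewrite /T /= inE => /orP[/eqP ->|hgs].
  have -> : f * (g ^+ i * v) * (y * g) = f * (g ^+ i.+1 * v * y) by rewrite exprS; ring.
  by rewrite addnS -addSn -addSn; apply: IHk => //; rewrite !addSn -addnS.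
have -> : f * (g ^+ i * v) * (y * h) = f * (g ^+ i * (h * v) * y) by ring.
rewrite addnS -addSn -addnS; apply: IHk => //; last by rewrite addnS addSn -addnS.
by apply: idmul_sub => //; exact: idgen_sub.
Qed.
End IdealPowers.

Lemma Delta_closure_fg (R : comPzRingType) (Delta : set (set R)) (I H : set R) f :
  noetherian R -> mult_closed Delta -> Delta H -> is_ideal H ->
  (forall g, H g -> exists m, idmul I (idpow H m) (f * g ^+ m)) ->
  Delta_closure Delta I f.
Proof.
move=> noethR multD DH idH fH; have [G /finite_seqP[gs ->] HE] := noethR H idH.
have [g ggs|m mP] := @idpow_generated R I H f gs idH.
  have Hg : H g by rewrite HE; exact: idgen_sub.
  by split=> //; exact: fH.
exists (idpow H m.+1); first by elim: m {mP} => [|m IHm]; [rewrite /= idmul_setT | exact: multD].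
by move=> x Hx; apply: mP => //; rewrite -HE.
Qed.

Lemma idgen_bij (A B : comPzRingType) (phi : {rmorphism A -> B}) (G : set A) x :
  bijective phi -> idgen [set phi g | g in G] (phi x) -> idgen G x.
Proof.
move=> [psi phiK psiK]; have idG := idgen_ideal G.
suff : idgen [set phi g | g in G] `<=` [set y | idgen G (psi y)].
  by move=> sub /sub /=; rewrite phiK.
apply: idgen_min => [|_ [g Gg <-]]; last by rewrite /= phiK; exact: idgen_sub.
split=> [|y z|b y] /=.
- by rewrite -(rmorph0 phi) phiK; exact: ideal0.
- by rewrite -{2}(psiK y) -{2}(psiK z) -rmorphD phiK; exact: idealD.
- by rewrite -(psiK b) -{2}(psiK y) -rmorphM phiK; exact: idealM.
Qed.

(** Sections over [range j] correspond bijectively to global sections of Spec A, where germs decide.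
    Membership over a set [W] around [j t] passes to the germ at [t], because [mor_sharp] commutes
    with restriction. *)
Lemma affine_idgen_local (Y : ringedSpace) (A : comPzRingType)
    (j : rs_morphism (Spec A) Y) (G : set (sec (range j))) (F : sec (range j)) :
  open_immersion j ->
  (forall y, range j y -> exists (W : set Y) (WU : W `<=` range j),
     W y /\ idgen [set res WU g | g in G] (res WU F)) ->
  idgen G F.
Proof.
move=> [_ oj bij] loc; apply: (idgen_bij (phi := mor_sharp j (range j))).
  by apply: bij => //; apply: oj; exact: openT.
apply: spec_idgen_local => [t|t Wt]; first by exists t.
have [W [WU [Wy WG]]] := loc (j t) Wt.
have germE (s : sec (range j)) :
    germ (X := spec_data A) (U := j @^-1` W) Wy (mor_sharp j W (res WU s)) =
    fs_at (X := spec_data A) (mor_sharp j (range j) s) Wt.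
  by rewrite mor_res /germ [LHS]mk_secE; exact: fs_atE.
have WG' : idgen [set mor_sharp j W (res WU g) | g in G] (mor_sharp j W (res WU F)).
  by apply: idgen_image WG => _ [g Gg <-]; apply: idgen_sub; exists g.
rewrite -germE; apply: idgen_image WG' => _ [g Gg <-]; apply: idgen_sub.
by exists (mor_sharp j (range j) g); [exists g | rewrite -germE].
Qed.

(** * The Rees algebra, and the passage from the colon ideal to the extended ideal *)

Section Rees.
Variables (R : comPzRingType) (H : set R).
Local Notation S := (rees_graded H).
Implicit Types x y z : S.

Lemma reesD x y k : (x + y) k = x k + y k. Proof. by []. Qed.
Lemma rees0 k : (0 : S) k = 0. Proof. by rewrite /=; case: ifP. Qed.
Lemma reesM x y k : (x * y) k = \sum_(i < k.+1) x i * y (k - i)%N.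
Proof. by []. Qed.

Lemma rees_deg0 k : gr_deg S k 0. Proof. by move=> j _; exact: rees0. Qed.
Arguments rees_deg0 : clear implicits.

Lemma rees_degN k x : gr_deg S k x -> gr_deg S k (- x).
Proof. by rewrite -sub0r; apply: gr_degB; exact: rees_deg0. Qed.

Lemma rees_mulh x y j k : gr_deg S j x -> (x * y) (j + k)%N = x j * y k.
Proof.
move=> xj; have jk : (j < (j + k).+1)%N by rewrite ltnS leq_addr.
rewrite reesM (bigD1 (Ordinal jk)) //= big1 ?addr0 ?addKn // => i ij.
by rewrite xj ?mul0r.
Qed.

Lemma rees_eqh x y k : gr_deg S k x -> gr_deg S k y -> x k = y k -> x = y.
Proof.
move=> xk yk xy; apply: rees_eq => j.
by have [->//|jk] := eqVneq j k; rewrite xk ?yk.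
Qed.

Lemma rees_constM a x k : (rees_const H a * x : S) k = a * x k.
Proof. by rewrite -{1}(add0n k) rees_mulh //; exact: rees_const_deg. Qed.

Program Definition rees_mono k a (ka : idpow H k a) : S :=
  @Rees R H (fun j => if j == k then a else 0) _ _.
Next Obligation.
move=> k a ka j /=; have [->//|_] := eqVneq j k; apply: ideal0; exact: idpow_ideal.
Qed.
Next Obligation. by move=> k a ka; exists k.+1 => j kj; rewrite gtn_eqF. Qed.

Lemma rees_monoE k a (ka : idpow H k a) : rees_mono ka k = a.
Proof. by rewrite /= eqxx. Qed.

Lemma rees_mono_deg k a (ka : idpow H k a) : gr_deg S k (rees_mono ka).
Proof. by move=> j /negbTE jk; rewrite /= jk. Qed.

Lemma idpow1 a : H a -> idpow H 1 a.
Proof. by move=> Ha; apply: idgen_sub; exists a => //; exists 1; rewrite ?mulr1. Qed.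

(* [rees_gen g] is the element gt of the Rees algebra. *)
Definition rees_gen g (Hg : H g) : S := rees_mono (idpow1 Hg).

(** The D+(gt) cover the blow-up because H^(k+1) is spanned by products g y with y in H^k: if [p]
    contained every gt, it would contain each (y t^k)(g t), hence the irrelevant ideal. *)
Lemma proj_point_gen (p : blowup H) : exists g (Hg : H g), ~ sval p (rees_gen Hg).
Proof.
case: p => p [pp hp nirr] /=; apply: contrapT => np; apply: nirr.
have [idp _ _] := pp.
have genp g (Hg : H g) : p (rees_gen Hg).
  by apply: contrapT => ng; apply: np; exists g, Hg.
apply: idgen_min => // x [[//|k] _ kx].
pose D := [set a | exists z, [/\ p z, gr_deg S k.+1 z & z k.+1 = a]].
suff [z [pz zk zx]] : D (x k.+1) by rewrite -(rees_eqh zk kx zx).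
have : idpow H k.+1 (x k.+1) by exact: rees_coefP.
suff : idpow H k.+1 `<=` D by apply.
apply: idgen_min => [|_ [g Hg [y ky <-]]].
  split=> [|_ _ [z [pz zk <-]] [w [pw wk <-]]|a _ [z [pz zk <-]]].
  - by exists 0; split; [exact: ideal0 | exact: rees_deg0 | exact: rees0].
  - exists (z + w); split=> //; first exact: idealD.
    by move=> j jk; rewrite reesD zk ?wk ?addr0.
  - exists (rees_const H a * z : S); split; first exact: idealM.
      by move=> j jk; rewrite rees_constM zk ?mulr0.
    exact: rees_constM.
exists (rees_mono ky * rees_gen Hg); split; first exact: idealM.
  by rewrite -addn1; apply: gr_degM; exact: rees_mono_deg.
by rewrite -addn1 rees_mulh ?rees_monoE 1?mulrC //; exact: rees_mono_deg.
Qed.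

Lemma blowup_pullbackE (U : set (blowup H)) (h : U `<=` setT) a t (Ut : U t) :
  fs_at (res h (pullback (blowup_mor H) a)) Ut =
  mkfrac (rees_const H a : S) (mset1 (fs_mulset (X := proj_data S) t)).
Proof.
rewrite [LHS]mk_secE [LHS]mk_secE [X in loc_map _ X]mk_secE.
by rewrite /loc_const loc_mapE; apply: mkfrac_eq; rewrite rmorph1.
Qed.

Lemma blowup_fractions_pullback (W : set (blowup H)) (I : set R) f g (Hg : H g) :
  (forall t, W t -> ~ sval t (rees_gen Hg)) -> idmul I H (f * g) ->
  idgen [set res (@subsetT _ W) (pullback (blowup_mor H) r) | r in I]
    (res (@subsetT _ W) (pullback (blowup_mor H) f)).
Proof.
move=> Wg fg; set G := [set res _ _ | r in I].
have idG := idgen_ideal G.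
have gM t : W t -> fs_mulset (X := proj_data S) t (rees_gen Hg).
  by move=> Wt; split; [exists 1%N => //; exact: rees_mono_deg | exact: Wg].
(* [D] consists of the [a] for which (a t)/(g t) is a section in [idgen G]. It is an ideal
   containing I H, as (a h t)/(g t) = a (h t)/(g t), and for f g the quotient is f. *)
pose D := [set a | exists s : sec W, idgen G s /\ exists2 z : S, gr_deg S 1 z &
  z 1%N = a /\ forall t (Wt : W t), fs_at s Wt = mkfrac z (gM t Wt)].
have [s [Gs [z z1 [zfg sz]]]] : D (f * g).
  suff : idmul I H `<=` D by apply.
  apply: idgen_min => [|_ [a Ia [h Hh <-]]].
    split=> [|_ _ [s [Gs [z z1 [<- sz]]]] [s' [Gs' [z' z1' [<- sz']]]]
            |a _ [s [Gs [z z1 [<- sz]]]]].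
    - exists 0; split; first exact: ideal0.
      exists 0; first exact: rees_deg0.
      split=> [|t Wt]; first exact: rees0.
      by rewrite fs_at0; apply: mkfrac_eq; ring.
    - exists (s + s'); split; first exact: idealD.
      exists (z + z'); first by move=> j jk; rewrite reesD z1 ?z1' ?addr0.
      split=> // t Wt; rewrite fs_atD sz sz' mkfracD.
      by apply: mkfrac_eq; ring.
    - exists (res (@subsetT _ W) (pullback (blowup_mor H) a) * s).
      split; first exact: idealM.
      exists (rees_const H a * z : S).
        by move=> j jk; rewrite rees_constM z1 ?mulr0.
      split=> [|t Wt]; first exact: rees_constM.
      rewrite fs_atM blowup_pullbackE sz mkfracM.
      by apply: mkfrac_eq; ring.
  have lf t : W t -> exists V : set (blowup H), [/\ open V, V t & exists c b : S,
      fs_frac (f := proj_data S) (c, b) /\ forall q (Wq : W q), V q ->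
      exists mb : fs_mulset (X := proj_data S) q b,
        mkfrac (rees_gen Hh) (gM q Wq) = mkfrac c mb].
    move=> Wt; exists setT; split=> //; first exact: openT.
    exists (rees_gen Hh), (rees_gen Hg); split.
      by exists 1%N; split; exact: rees_mono_deg.
    by move=> q Wq _; exists (gM q Wq).
  exists (mk_sec lf * res (@subsetT _ W) (pullback (blowup_mor H) a)).
  split; first by apply: idealM => //; apply: idgen_sub; exists a.
  exists (rees_const H a * rees_gen Hh : S).
    by move=> j jk; rewrite rees_constM rees_mono_deg ?mulr0.
  split=> [|t Wt]; first by rewrite rees_constM rees_monoE.
  rewrite fs_atM blowup_pullbackE mk_secE mkfracM.
  by apply: mkfrac_eq; ring.
suff -> : res (@subsetT _ W) (pullback (blowup_mor H) f) = s by [].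
apply: fs_sec_eq => t Wt; rewrite blowup_pullbackE sz; apply: mkfrac_eq.
rewrite mulr1; apply: (@rees_eqh _ _ 1%N) => //.
  by move=> j jk; rewrite rees_constM rees_mono_deg ?mulr0.
by rewrite rees_constM rees_monoE.
Qed.

Lemma colon_in_ext_ideal (I : set R) f :
  idcolon (idmul I H) H f -> in_ext_ideal (blowup_mor H) I f.
Proof.
move=> fH U UT [A [j [oj jU]]]; subst U; apply: affine_idgen_local => // p jp.
have [g [Hg ng]] := proj_point_gen p.
pose W : set (blowup H) := range j `&` [set t | ~ sval t (rees_gen Hg)].
have WU : W `<=` range j by move=> t [].
exists W, WU; split=> //.
have resE r h : res WU (res h (pullback (blowup_mor H) r)) =
    res (@subsetT _ W) (pullback (blowup_mor H) r) by exact: res_comp.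
rewrite resE; have := @blowup_fractions_pullback W I f g Hg _ (fH g Hg).
case=> [t []//|n [a [s [Gs ->]]]]; exists n, a, s; split=> // i.
have [r Ir <-] := Gs i; exists (res (@subsetT _ (range j)) (pullback (blowup_mor H) r)).
  by exists r.
exact: resE.
Qed.

End Rees.
Arguments rees_deg0 {R H} k.
Arguments rees_degN {R H} k x _.

(** * Homogeneous components *)

Section ReesComponents.
Variables (R : comPzRingType) (H : set R).
Local Notation S := (rees_graded H).
Implicit Types (x y : S) (p : set S).

Definition component x k : S := rees_comp x k.

Lemma componentE x k j : component x k j = if j == k then x k else 0.
Proof. by []. Qed.

Lemma component_deg x k : gr_deg S k (component x k).
Proof. by move=> j /negbTE jk; rewrite componentE jk. Qed.

Arguments component_deg : clear implicits.

Lemma componentD x y k : component (x + y) k = component x k + component y k.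
Proof.
by apply: rees_eq => j; rewrite reesD !componentE; case: ifP; rewrite ?addr0.
Qed.

Lemma component0 k : component 0 k = 0.
Proof. by apply: rees_eq => j; rewrite componentE !rees0; case: ifP. Qed.

Lemma component_homogeneous x k j : gr_deg S k x ->
  component x j = if j == k then x else 0.
Proof.
move=> xk; apply: rees_eq => i; rewrite componentE.
have [->|jk] := eqVneq j k; first by case: eqVneq => [->//|ik]; rewrite xk.
by rewrite rees0 (xk j) //; case: ifP.
Qed.

Lemma component_sum x : exists n, x = \sum_(k < n) component x k.
Proof.
have [n xn] := rees_fin x; exists n; apply: rees_eq => j; rewrite rees_sumE.
have [jn|nj] := ltnP j n.
  rewrite (bigD1 (Ordinal jn)) //= eqxx big1 ?addr0 // => i ij.
  by rewrite eq_sym (negbTE (ij : (i : nat) != j)).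
rewrite xn // big1 // => i _; rewrite componentE gtn_eqF //.
exact: leq_trans (ltn_ord i) nj.
Qed.

Lemma componentM x y k :
  component (x * y) k = \sum_(i < k.+1) component x i * component y (k - i)%N.
Proof.
have sumE := rees_sumE k.+1 (fun i => component x i * component y (k - i)%N).
apply: (@rees_eqh _ _ _ _ k); first exact: component_deg.
  move=> j jk; rewrite sumE big1 // => i _; have ik : (i <= k)%N by rewrite -ltnS.
  have := gr_degM (component_deg x i) (component_deg y (k - i)).
  by rewrite subnKC // => /(_ j jk).
rewrite componentE eqxx reesM sumE; apply: eq_bigr => i _.
have ik : (i <= k)%N by rewrite -ltnS.
have := @rees_mulh _ _ (component x i) (component y (k - i)) i (k - i) (component_deg _ _).
by rewrite subnKC // !componentE !eqxx.
Qed.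

Lemma homogeneous_component p x k : homogeneous_ideal p -> p x -> p (component x k).
Proof.
move=> [idp ->]; set P := idgen _; have idP : is_ideal P by exact: idgen_ideal.
suff : P `<=` [set x | forall k, P (component x k)] by move=> sub /sub.
apply: idgen_min => [|y [py [j _ yj]] i].
  split=> [i|y z Py Pz i|a y Py i] /=.
  - by rewrite component0; exact: ideal0.
  - by rewrite componentD; exact: idealD.
  - by rewrite componentM; apply: ideal_sum => // l; exact: idealM.
rewrite (component_homogeneous _ yj); case: ifP => _; last exact: ideal0.
by apply: idgen_sub; split=> //; exists j.
Qed.

End ReesComponents.
Arguments component_deg {R H} x k.

(** * The chart D+(G) as an open immersion of Spec A *)

(* [psi] exhibits [A] as the degree-zero part of the Rees algebra localized at the
   degree-one element [G], under x t^k / G^k <-> psi (x t^k). *)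
Section Chart.
Variables (R : comPzRingType) (H : set R).
Local Notation S := (rees_graded H).
Variables (G : S) (A : comPzRingType) (psi : {rmorphism S -> A}).
Hypothesis G1 : gr_deg S 1 G.
Hypothesis psiG : psi G = 1.
Hypothesis psi_surj : forall a, exists k x, gr_deg S k x /\ psi x = a.
(** Demanded of homogeneous elements only: [G - 1] also lies in the kernel, and powers of [G] do not
    kill it in general. *)
Hypothesis psi_ker : forall k x, gr_deg S k x -> psi x = 0 -> exists n, G ^+ n * x = 0.
Implicit Types (q : set A) (t : Spec A) (x y : S).

Lemma psiGX n : psi (G ^+ n) = 1.
Proof. by rewrite rmorphXn psiG expr1n. Qed.

Lemma G_deg n : gr_deg S n (G ^+ n).
Proof.
elim: n => [|n IHn]; first exact: gr_deg1.
by rewrite exprS -add1n; exact: gr_degM.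
Qed.

Arguments G_deg : clear implicits.

(** The preimage of [q] under [psi] contains [G - 1], so it is not the required homogeneous prime;
    [cone q] is the largest homogeneous ideal inside it. *)
Definition cone q : set S := [set x | forall k, q (psi (component x k))].

Lemma cone_homogeneous q k x : is_ideal q -> gr_deg S k x ->
  cone q x <-> q (psi x).
Proof.
move=> idq xk; split=> [/(_ k)|qx j]; rewrite (component_homogeneous _ xk) ?eqxx //.
by case: ifP => // _; rewrite rmorph0; exact: ideal0.
Qed.

(** If the lowest components of [x] and [y] outside [q] have degrees i and j, then in degree i + j
    of the product every other term has a factor in [q]. *)
Lemma cone_prime q : prime_ideal q -> prime_ideal (cone q).
Proof.
move=> [idq q1 qM]; split.
- split=> [k|x y qx qy k|x y qy k].
  + by rewrite component0 rmorph0; exact: ideal0.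
  + by rewrite componentD rmorphD; exact: idealD.
  + rewrite componentM rmorph_sum; apply: ideal_sum => // i.
    by rewrite rmorphM; exact: idealM.
- by rewrite (cone_homogeneous idq (gr_deg1 S)) rmorph1.
have least x : ~ cone q x -> exists i, ~ q (psi (component x i)) /\
    forall j, (j < i)%N -> q (psi (component x j)).
  move=> /existsNP[i0 ni0].
  have ex : exists i, `[< ~ q (psi (component x i)) >] by exists i0; exact/asboolP.
  case: (ex_minnP ex) => i /asboolP ni imin; exists i; split=> // j ji.
  by apply: contrapT => /asboolP /imin; rewrite leqNgt ji.
move=> x y qxy; apply: contrapT => /not_orP[/least[i [ni imin]] /least[j [nj jmin]]].
have ij : (i < (i + j).+1)%N by rewrite ltnS leq_addr.
have := qxy (i + j)%N; rewrite componentM (bigD1 (Ordinal ij)) //= addKn rmorphD rmorphM.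
set r := (X in _ + X); have qr : q r.
  rewrite /r rmorph_sum; elim/big_ind: _ => [|a b|l li]; first exact: ideal0.
    exact: idealD.
  rewrite rmorphM; case: (ltngtP l i) => [li'|il|e]; last by rewrite -val_eqE /= e eqxx in li.
    by rewrite mulrC; apply: idealM => //; exact: imin.
  apply: idealM => //; apply: jmin; rewrite ltn_subLR ?ltn_add2r //.
  by rewrite -ltnS.
by move=> /(idealB idq) /(_ qr); rewrite addrK => /qM[].
Qed.

Lemma chart_base_subproof t : is_proj_point (S := S) (cone (sval t)).
Proof.
have [idt t1 _] := svalP t.
have pc := cone_prime (svalP t); have [idc _ _] := pc; split=> //.
  split=> //; apply/seteqP; split=> [x cx|]; last by apply: idgen_min => // x [].
  have [n ->] := component_sum x; apply: ideal_sum => [|k]; first exact: idgen_ideal.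
  apply: idgen_sub; split; last by exists k => //; exact: component_deg.
  apply/(cone_homogeneous idt (component_deg x k)); exact: cx.
move=> sub; have : cone (sval t) G by apply: sub; apply: idgen_sub; exists 1%N.
by rewrite (cone_homogeneous idt G1) psiG.
Qed.

Definition chart_base t : blowup H := exist _ _ (chart_base_subproof t).

Lemma mem_chart t k x : gr_deg S k x ->
  sval (chart_base t) x <-> sval t (psi x).
Proof. by move=> xk; have [idt _ _] := svalP t; exact: cone_homogeneous idt xk. Qed.

Lemma chart_inj : injective chart_base.
Proof.
move=> t u e; have : sval t = sval u.
  apply/seteqP; split=> a; have [k [x [xk <-]]] := psi_surj a.
    by rewrite -!(mem_chart _ xk) e.
  by rewrite -!(mem_chart _ xk) e.
case: t u {e} => [p pp] [p' pp'] /= e; subst p'.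
by congr exist; exact: Prop_irrelevance.
Qed.

(** The preimage of [p] is the set [q] of values of [psi] on homogeneous elements of [p]. The point
    is [qP]: membership in [p] depends only on the value under [psi], because [G] is outside [p]. *)
Lemma chart_range (p : blowup H) : ~ sval p G -> range chart_base p.
Proof.
case: p => p pP /= nG; have [pp hp _] := pP; have [idp p1 pM] := pp.
have nGX n : ~ p (G ^+ n) by move=> /(prime_exp pp).
pose q : set A := [set a | exists k x, [/\ gr_deg S k x, p x & psi x = a]].
have qP k x : gr_deg S k x -> q (psi x) -> p x.
  move=> xk [l [y [yl py yx]]].
  have kl : gr_deg S (k + l) (x * G ^+ l - y * G ^+ k).
    by apply: gr_degB; [|rewrite addnC]; apply: gr_degM => //; exact: G_deg.
  (* Powers of [G], which [psi] sends to 1, bring [x] and [y] to the common degree k + l, where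
     [psi_ker] applies. *)
  have [n xyn] : exists n, G ^+ n * (x * G ^+ l - y * G ^+ k) = 0.
    by apply: psi_ker kl _; rewrite rmorphB !rmorphM !psiGX yx subrr.
  have : p (G ^+ n * (x * G ^+ l - y * G ^+ k)) by rewrite xyn; exact: ideal0.
  case/pM => [/nGX//|pxy].
  have : p (x * G ^+ l).
    by rewrite -(subrK (y * G ^+ k) (x * _)); apply: idealD => //; rewrite mulrC; exact: idealM.
  by case/pM => [//|/nGX].
have pq : prime_ideal q.
  split.
  - split=> [|_ _ [k [x [xk px <-]]] [l [y [yl py <-]]]|a _ [k [x [xk px <-]]]].
    + by exists 0%N, 0; split; [exact: rees_deg0|exact: ideal0|exact: rmorph0].
    + exists (k + l)%N, (x * G ^+ l - - (y * G ^+ k)); split.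
      * apply: gr_degB; first by apply: gr_degM => //; exact: G_deg.
        by apply: rees_degN; rewrite addnC; apply: gr_degM => //; exact: G_deg.
      * by rewrite opprK; apply: idealD => //; rewrite mulrC; exact: idealM.
      * by rewrite opprK rmorphD !rmorphM !psiGX !mulr1.
    + have [l [y [yl <-]]] := psi_surj a; exists (l + k)%N, (y * x); split.
      * exact: gr_degM.
      * exact: idealM.
      * exact: rmorphM.
  - by rewrite -(rmorph1 psi) => /(qP _ _ (gr_deg1 S)).
  - move=> a b; have [k [x [xk <-]]] := psi_surj a; have [l [y [yl <-]]] := psi_surj b.
    rewrite -rmorphM => /(qP _ _ (gr_degM xk yl)) /pM[px|py]; [left|right].
      by exists k, x.
    by exists l, y.
exists (exist _ q pq) => //.
suff e : cone q = p.
  rewrite /chart_base /=; move: (chart_base_subproof _) => /= cP.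
  by case: _ / e pP cP {hp pp idp p1 pM nGX qP pq nG} => *; congr exist; exact: Prop_irrelevance.
apply/seteqP; split=> x.
  move=> cx; have [n ->] := component_sum x; apply: ideal_sum => // k.
  exact/(qP _ _ (component_deg x k)).
move=> px k; exists k, (component x k); split=> //; first exact: component_deg.
exact: homogeneous_component.
Qed.

Lemma chart_cont : continuous chart_base.
Proof.
apply/continuousP => _ [E ->].
exists [set a | exists x k, E x /\ a = psi (component x k)].
apply/seteqP; split=> t /= nE sub; apply: nE => x.
  by move=> Ex k; apply: sub; exists x, k.
by move=> [y [k [Ey ->]]]; exact: sub.
Qed.

Lemma chart_open (U : set (Spec A)) : open U -> open (chart_base @` U).
Proof.
(* The factor [G] confines the open set to D+(G), hence to the image of the chart. *)
move=> [E ->]; exists [set G * x | x in [set x | homogeneous x /\ E (psi x)]].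
apply/seteqP; split=> [_ [t nE <-] sub|p /= nE].
  apply: nE => a Ea; have [k [x [xk xa]]] := psi_surj a.
  have [idt t1 _] := svalP t; have [_ _ pM] := cone_prime (svalP t).
  have : cone (sval t) (G * x) by apply: sub; exists x => //; split; [exists k | rewrite xa].
  case/pM; first by rewrite (cone_homogeneous idt G1) psiG.
  by rewrite (cone_homogeneous idt xk) xa.
have [pp _ _] := svalP p; have [idp _ _] := pp.
have [x [[k _ xk] Ex] np] : exists2 x, homogeneous x /\ E (psi x) & ~ sval p (G * x).
  apply: contrapT => nx; apply: nE => _ [x hx <-]; apply: contrapT => np.
  by apply: nx; exists x.
have [|t _ tp] := chart_range (p := p).
  by move=> pG; apply: np; rewrite mulrC; exact: idealM.
exists t => // sub; apply: np; apply: idealM => //.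
by rewrite -tp; apply/(mem_chart t xk)/sub.
Qed.

Lemma chart_mulset t (b : S) : fs_mulset (X := proj_data S) (chart_base t) b ->
  fs_mulset (X := spec_data A) t (psi b).
Proof. by case=> -[k _ bk] nb; split=> // /(mem_chart t bk). Qed.

Definition chart_germ t :
    fs_germ (X := proj_data S) (chart_base t) -> fs_germ (X := spec_data A) t :=
  loc_map (@chart_mulset t).

(* [fs_germ] allows numerators of all degrees, on which [chart_germ] is not injective. *)
Definition degree0 (p : blowup H) (c : fs_germ (X := proj_data S) p) : Prop :=
  exists a b : S, proj_frac (a, b) /\
    exists mb : fs_mulset (X := proj_data S) p b, c = mkfrac a mb.

Lemma fs_at_degree0 (V : set (blowup H)) (s : fs_sec (X := proj_data S) V) p (Vp : V p) :
  degree0 (fs_at s Vp).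
Proof.
have [W [_ Wp [a [b [ab sab]]]]] := fs_secP s Vp.
by have [mb sE] := sab p Vp Wp; exists a, b; split=> //; exists mb.
Qed.

(** Equal degrees of numerator and denominator make the lifted cross difference homogeneous, so a
    power of [G] kills it; that power is an admissible multiplier, since [psi] sends it to 1. *)
Lemma chart_germ_inj t c c' : degree0 c -> degree0 c' ->
  @chart_germ t c = chart_germ c' -> c = c'.
Proof.
move=> [a [b [[k [/= ak bk]] [mb ->]]]] [a' [b' [[l [/= al bl]] [mb' ->]]]].
rewrite /chart_germ !loc_mapE => /mkfracP[u /spec_mulsetN nu].
have [m [y [ym yu]]] := psi_surj u; rewrite -yu -!rmorphM => e.
have zd : gr_deg S (m + (k + l)) (y * (a * b') - y * (a' * b)).
  by apply: gr_degB; apply: gr_degM => //; [|rewrite addnC]; exact: gr_degM.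
have [n zn] : exists n, G ^+ n * (y * (a * b') - y * (a' * b)) = 0.
  by apply: psi_ker zd _; rewrite rmorphB e subrr.
apply/mkfracP; exists (G ^+ n * y).
  split; first by exists (n + m)%N => //; apply: gr_degM => //; exact: G_deg.
  have [_ _ pM] := svalP (chart_base t).
  have nyd : gr_deg S (n + m) (G ^+ n * y) by apply: gr_degM => //; exact: G_deg.
  by move=> /(mem_chart t nyd); rewrite rmorphM psiGX mul1r yu.
by apply/eqP; rewrite -subr_eq0 -!mulrA -mulrBr zn.
Qed.

Section ChartSharp.
Variable V : set (blowup H).

Lemma chart_sharp_subproof (s : fs_sec (X := proj_data S) V) t :
  (chart_base @^-1` V) t -> exists W : set (Spec A), [/\ open W, W t & exists a b : A,
    fs_frac (f := spec_data A) (a, b) /\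
    forall u (Vu : (chart_base @^-1` V) u), W u ->
    exists mb : fs_mulset (X := spec_data A) u b,
      chart_germ (fs_at (t := chart_base u) s Vu) = mkfrac a mb].
Proof.
move=> Vt; have [W [oW Wt [a [b [ab e]]]]] := fs_secP s Vt.
exists (chart_base @^-1` W); split=> //; first by move/continuousP : chart_cont; apply.
exists (psi a), (psi b); split=> // u Vu Wu; have [mb {}e] := e _ Vu Wu.
by exists (chart_mulset mb); rewrite e /chart_germ loc_mapE.
Qed.

Definition chart_sharp (s : fs_sec (X := proj_data S) V) :
    fs_sec (X := spec_data A) (chart_base @^-1` V) :=
  mk_sec (@chart_sharp_subproof s).

Lemma chart_sharpE s t (Vt : (chart_base @^-1` V) t) :
  fs_at (chart_sharp s) Vt = chart_germ (fs_at (t := chart_base t) s Vt).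
Proof. by []. Qed.

Lemma chart_sharp_zmod : zmod_morphism chart_sharp.
Proof.
move=> s s'; apply: fs_sec_eq => t Vt.
exact: (loc_map_zmod (@chart_mulset t)).
Qed.

Lemma chart_sharp_monoid : monoid_morphism chart_sharp.
Proof.
split=> [|s s']; apply: fs_sec_eq => t Vt; rewrite [LHS]mk_secE; last first.
  rewrite [in RHS]fs_atM !chart_sharpE fs_atM.
  by have [_] := loc_map_monoid (@chart_mulset t); apply.
exact: rmorph1.
Qed.

HB.instance Definition _ := GRing.isZmodMorphism.Build
  (fs_sec (X := proj_data S) V) (fs_sec (X := spec_data A) (chart_base @^-1` V))
  chart_sharp chart_sharp_zmod.
HB.instance Definition _ := GRing.isMonoidMorphism.Build
  (fs_sec (X := proj_data S) V) (fs_sec (X := spec_data A) (chart_base @^-1` V))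
  chart_sharp chart_sharp_monoid.

Hypothesis Vopen : open V.
Hypothesis Vrange : V `<=` range chart_base.

Lemma chart_sharp_inj : injective chart_sharp.
Proof.
move=> s s' e; apply: fs_sec_eq => p Vp; have [t _ tp] := Vrange Vp; subst p.
apply: chart_germ_inj; try exact: fs_at_degree0.
by have := congr1 (fun z => @fs_at _ _ z t Vp) e; rewrite !chart_sharpE.
Qed.

(** x/y need not have degree zero; the factors [G ^+ l] and [G ^+ k] bring both terms to degree k +
    l without changing their values under [psi]. *)
Lemma chart_germ_frac t k l x y : gr_deg S k x -> gr_deg S l y ->
  forall my : fs_mulset (X := spec_data A) t (psi y),
  exists m : fs_mulset (X := proj_data S) (chart_base t) (y * G ^+ k),
    chart_germ (mkfrac (x * G ^+ l) m) = mkfrac (psi x) my.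
Proof.
move=> xk yl my; have yd : gr_deg S (l + k) (y * G ^+ k).
  by apply: gr_degM => //; exact: G_deg.
have m : fs_mulset (X := proj_data S) (chart_base t) (y * G ^+ k).
  split; first by exists (l + k)%N.
  by move=> /(mem_chart t yd); rewrite rmorphM psiGX mulr1; exact: spec_mulsetN my.
exists m; rewrite /chart_germ loc_mapE; apply: mkfrac_eq.
by rewrite !rmorphM !psiGX !mulr1.
Qed.

Lemma chart_frac_deg k l x y : gr_deg S k x -> gr_deg S l y ->
  proj_frac (x * G ^+ l, y * G ^+ k).
Proof.
move=> xk yl; have xG := gr_degM xk (G_deg l); exists (k + l)%N; split=> //.
by have yG := gr_degM yl (G_deg k); rewrite (addnC l k) in yG.
Qed.

Lemma chart_sharp_surj (s : fs_sec (X := spec_data A) (chart_base @^-1` V)) :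
  exists s', chart_sharp s' = s.
Proof.
(* Germs at [p] and at [chart_base t] have different types. Quantifying over [t] and [e] makes the
   germ chosen at [p] usable without fixing a preimage; by [chart_inj] only one [t] occurs. *)
have ex p (Vp : V p) : exists c : fs_germ (X := proj_data S) p, degree0 c /\
    forall t (e : p = chart_base t) (Vt : V (chart_base t)),
      chart_germ (ecast z (fs_germ (X := proj_data S) z) e c) =
      fs_at (U := chart_base @^-1` V) s Vt.
  have [t _ tp] := Vrange Vp; subst p.
  have [W [_ Wt [a [b [_ sab]]]]] := fs_secP s (Vp : (chart_base @^-1` V) t).
  have [mb sE] := sab t Vp Wt.
  have [k [x [xk xa]]] := psi_surj a; have [l [y [yl yb]]] := psi_surj b; subst a b.
  have [m mE] := chart_germ_frac xk yl mb.
  exists (mkfrac (x * G ^+ l) m); split.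
    exists (x * G ^+ l), (y * G ^+ k); split; first exact: chart_frac_deg.
    by exists m.
  move=> u e Vu; have ut := chart_inj e; subst u.
  rewrite (Prop_irrelevance e erefl) /= mE -sE.
  exact: (@fs_atE (spec_data A) (chart_base @^-1` V) s t Vp Vu).
pose c p (Vp : V p) := sval (cid (ex p Vp)).
have c0 p (Vp : V p) : degree0 (c p Vp) by rewrite /c; case: cid => ? [].
have cE t (Vt : V (chart_base t)) :
    chart_germ (c _ Vt) = fs_at (U := chart_base @^-1` V) s Vt.
  by rewrite /c; case: cid => d [_ dE] /=; exact: (dE t erefl Vt).
have clf p : V p -> exists W : set (blowup H), [/\ open W, W p & exists a b : S,
    fs_frac (f := proj_data S) (a, b) /\ forall r (Vr : V r), W r ->
    exists mb : fs_mulset (X := proj_data S) r b, c r Vr = mkfrac a mb].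
  move=> Vp; have [t _ tp] := Vrange Vp; subst p.
  have [W [oW Wt [a [b [_ sab]]]]] := fs_secP s (Vp : (chart_base @^-1` V) t).
  have [k [x [xk xa]]] := psi_surj a; have [l [y [yl yb]]] := psi_surj b; subst a b.
  exists (chart_base @` W); split; [exact: chart_open | by exists t|].
  exists (x * G ^+ l), (y * G ^+ k); split; first exact: chart_frac_deg.
  move=> r Vr [u Wu ur]; subst r.
  have [mb sE] := sab u Vr Wu; have [m mE] := chart_germ_frac xk yl mb.
  (* The germ chosen at each point has no evident relation to the fraction near it; both have degree
     zero and the same image, so they coincide. *)
  exists m; apply: chart_germ_inj => //; last by rewrite cE mE -sE.
  exists (x * G ^+ l), (y * G ^+ k); split; first exact: chart_frac_deg.
  by exists m.
exists (mk_sec clf); apply: fs_sec_eq => t Vt.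
by rewrite chart_sharpE mk_secE cE.
Qed.

Lemma chart_sharp_bij : bijective chart_sharp.
Proof.
have /choice[r rK] := chart_sharp_surj.
by exists r => // s; apply: chart_sharp_inj; rewrite rK.
Qed.

End ChartSharp.

Program Definition chart_mor : rs_morphism (Spec A) (blowup H) :=
  @RsMorphism (Spec A) (blowup H) chart_base chart_cont (fun V => @chart_sharp V) _.
Next Obligation.
move=> U V h s; apply: fs_sec_eq => t Vt.
rewrite [LHS]mk_secE [RHS]mk_secE [RHS]mk_secE.
by congr (chart_germ _); rewrite [LHS]mk_secE; exact: fs_atE.
Qed.

Lemma chart_open_immersion : open_immersion chart_mor.
Proof.
split; [exact: chart_inj | exact: chart_open |].
by move=> V oV Vr; exact: chart_sharp_bij.
Qed.

Lemma chart_pullback (U : set (blowup H)) (h : U `<=` setT) a :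
  mor_sharp chart_mor U (res h (pullback (blowup_mor H) a)) =
  spec_consts (chart_base @^-1` U) (psi (rees_const H a)).
Proof.
apply: fs_sec_eq => t Ut; rewrite [LHS]chart_sharpE spec_constsE.
by rewrite blowup_pullbackE /chart_germ loc_mapE; apply: mkfrac_eq; rewrite rmorph1.
Qed.

Lemma rees_expE n : (G ^+ n) n = G 1%N ^+ n.
Proof.
elim: n => [|n IHn]; first by [].
by rewrite exprS -{1}[n.+1]add1n rees_mulh // IHn -exprS.
Qed.

Lemma in_ext_ideal_exp (I : set R) f :
  in_ext_ideal (blowup_mor H) I f -> exists m, idmul I (idpow H m) (f * G 1%N ^+ m).
Proof.
have aff : affine_open (range chart_mor).
  by exists A, chart_mor; split=> //; exact: chart_open_immersion.
move=> /(_ (range chart_mor) (@subsetT _ _) aff) fI.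
(* Along [mor_sharp chart_mor] and the identification of global sections with [A], the hypothesis
   becomes membership in the extension of [I] to [A]. *)
have {}fI : idgen [set psi (rees_const H r) | r in I] (psi (rees_const H f)).
  have full t : (chart_base @^-1` range chart_mor) t by exists t.
  apply: (idgen_bij (phi := spec_consts (chart_base @^-1` range chart_mor))).
    have /choice[r rK] := spec_consts_surj full.
    by exists r => // a; apply: (spec_consts_inj full); rewrite -rK.
  rewrite -[X in idgen _ X](chart_pullback (@subsetT _ _)).
  apply: (idgen_image (phi := mor_sharp chart_mor _)) fI => _ [r Ir <-].
  apply: idgen_sub; exists (psi (rees_const H r)); first by exists r.
  by rewrite -[LHS](chart_pullback (@subsetT _ _)).
(* Every element of I A has a homogeneous representative with coefficient in I H^k: two summands are
   first raised to degree k + l by powers of [G]. *)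
pose D := [set a | exists k x,
  [/\ gr_deg S k x, psi x = a & idmul I (idpow H k) (x k)]].
have [k [x [xk xf Ix]]] : D (psi (rees_const H f)).
  suff : idgen [set psi (rees_const H r) | r in I] `<=` D by apply.
  apply: idgen_min => [|_ [r Ir <-]]; last first.
    exists 0%N, (rees_const H r); split=> //; first exact: rees_const_deg.
    by rewrite /= -[r]mulr1; exact: idmul_sub.
  split=> [|_ _ [k [x [xk <- Ix]]] [l [y [yl <- Iy]]]|a _ [k [x [xk <- Ix]]]].
  - exists 0%N, 0; split; [exact: rees_deg0 | exact: rmorph0|].
    by rewrite rees0; apply: ideal0; exact: idgen_ideal.
  - exists (k + l)%N, (x * G ^+ l + y * G ^+ k); split.
    + rewrite -[y * _]opprK; apply: gr_degB; first exact: gr_degM xk (G_deg l).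
      by apply: rees_degN; rewrite addnC; exact: gr_degM yl (G_deg k).
    + by rewrite rmorphD !rmorphM !psiGX !mulr1.
    + rewrite reesD rees_mulh // {2}addnC rees_mulh //.
      apply: idealD; first exact: idgen_ideal.
        by apply: idmul_idpowM => //; exact: rees_coefP.
      by rewrite addnC; apply: idmul_idpowM => //; exact: rees_coefP.
  - have [l [y [yl <-]]] := psi_surj a; exists (l + k)%N, (y * x); split.
    + exact: gr_degM.
    + exact: rmorphM.
    + by rewrite rees_mulh // mulrC addnC; apply: idmul_idpowM => //; exact: rees_coefP.
have zd : gr_deg S k (rees_const H f * G ^+ k - x).
  by apply: gr_degB => //; rewrite -[k]add0n; exact: gr_degM (rees_const_deg H f) (G_deg k).
have [n zn] : exists n, G ^+ n * (rees_const H f * G ^+ k - x) = 0.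
  by apply: psi_ker zd _; rewrite rmorphB rmorphM psiGX mulr1 xf subrr.
(* k is the degree of the representative [x] of f, and n the power of [G] killing the difference.
   The coefficient in degree n + k then gives f g^(k+n) = x_k g^n, with g the coefficient of [G]. *)
exists (k + n)%N; suff -> : f * G 1%N ^+ (k + n) = x k * (G ^+ n) n.
  by apply: idmul_idpowM => //; exact: rees_coefP.
have := congr1 (fun z : S => z (n + k)%N) zn.
rewrite (rees_mulh _ _ (G_deg n)) rees0 reesD rees_constM !rees_expE => e.
rewrite exprD; apply/eqP; rewrite -subr_eq0 -[X in _ == X]e; apply/eqP.
have -> : (- x : S) k = - x k by [].
by ring.
Qed.

End Chart.
Arguments G_deg {R H G} G1 n.

(** * The image of a ring morphism as a ring *)

Section Image.
Variables (B C : comPzRingType) (phi : {rmorphism B -> C}).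

Definition in_image : pred C := fun u => `[< exists x, u = phi x >].

Record image_ring := ImageRing { image_val : C; _ : in_image image_val }.
HB.instance Definition _ := [isSub for image_val].
HB.instance Definition _ := [Choice of image_ring by <:].

Lemma in_image_subring : subring_closed in_image.
Proof.
split=> [|_ _ /asboolP[x ->] /asboolP[y ->]|_ _ /asboolP[x ->] /asboolP[y ->]].
- by apply/asboolP; exists 1; rewrite rmorph1.
- by apply/asboolP; exists (x - y); rewrite rmorphB.
- by apply/asboolP; exists (x * y); rewrite rmorphM.
Qed.

HB.instance Definition _ := GRing.SubChoice_isSubComPzRing.Build
  C in_image image_ring in_image_subring.

Lemma to_image_subproof x : in_image (phi x).
Proof. by apply/asboolP; exists x. Qed.

Definition to_image x : image_ring := ImageRing (to_image_subproof x).

Lemma to_image_zmod : zmod_morphism to_image.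
Proof. by move=> x y; apply: val_inj; rewrite /= rmorphB. Qed.
Lemma to_image_monoid : monoid_morphism to_image.
Proof.
by split=> [|x y]; apply: val_inj; rewrite /= ?rmorph1 ?rmorphM.
Qed.
HB.instance Definition _ := GRing.isZmodMorphism.Build B image_ring to_image to_image_zmod.
HB.instance Definition _ := GRing.isMonoidMorphism.Build B image_ring to_image to_image_monoid.

Lemma to_image_surj u : exists x, to_image x = u.
Proof.
by case: u => u ui; have /asboolP[x ux] := ui; exists x; apply: val_inj; rewrite /= -ux.
Qed.

Lemma to_image_eq0 x : to_image x = 0 -> phi x = 0.
Proof. by move=> /(congr1 val). Qed.

End Image.

(** * The chart ring R[H/g] *)

Section Dehomogenization.
Variables (R : comPzRingType) (H : set R) (g : R) (Hg : H g).
Local Notation S := (rees_graded H).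
Local Notation Rg := (loc (powers g)).
Implicit Types x y : S.

Lemma powersX k : powers g (g ^+ k). Proof. by exists k. Qed.

Let term x k : Rg := mkfrac (x k) (powersX k).

(** The substitution of 1/g for t, whose image is R[H/g]. The bound is one provided by [rees_fin];
    [dehomE] allows any other. *)
Definition dehom x : Rg := \sum_(k < sval (cid (rees_fin x))) term x k.

Lemma loc0E (M : mulset R) b (Mb : M b) : mkfrac 0 Mb = 0 :> loc M.
Proof. by apply: mkfrac_eq; ring. Qed.

Lemma dehomE x n : (forall k, (n <= k)%N -> x k = 0) -> dehom x = \sum_(k < n) term x k.
Proof.
move=> xn; rewrite /dehom; case: cid => m /= xm.
have cut i j : (forall k, (i <= k)%N -> x k = 0) ->
    \sum_(k < i) term x k = \sum_(k < i + j) term x k.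
  move=> xi; rewrite big_split_ord /= [X in _ = _ + X]big1 ?addr0 // => k _.
  by rewrite /term xi ?leq_addr // loc0E.
by rewrite (cut m n xm) addnC -cut.
Qed.

Lemma dehom_homogeneous x k : gr_deg S k x -> dehom x = mkfrac (x k) (powersX k).
Proof.
move=> xk; rewrite (@dehomE x k.+1) => [|j kj]; last by apply: xk; rewrite gtn_eqF.
rewrite big_ord_recr /= big1 ?add0r // => i _.
by rewrite /term (xk i) ?loc0E // ltn_eqF.
Qed.

Lemma dehom_zmod : zmod_morphism dehom.
Proof.
move=> x y; have [m xm] := rees_fin x; have [n yn] := rees_fin y.
have xmn k : (m + n <= k)%N -> x k = 0 by move=> mnk; apply/xm/(leq_trans _ mnk)/leq_addr.
have ymn k : (m + n <= k)%N -> y k = 0 by move=> mnk; apply/yn/(leq_trans _ mnk)/leq_addl.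
rewrite (dehomE xmn) (dehomE ymn) (@dehomE (x - y) (m + n)) => [|k mnk]; last first.
  by rewrite reesD xmn // add0r; apply/eqP; rewrite oppr_eq0; apply/eqP/ymn.
rewrite -sumrB; apply: eq_bigr => k _; rewrite /term mkfracN mkfracD.
apply: mkfrac_eq; have -> : (x - y) k = x k - y k by [].
by ring.
Qed.
HB.instance Definition _ := GRing.isZmodMorphism.Build S Rg dehom dehom_zmod.

Lemma dehom_monoid : monoid_morphism dehom.
Proof.
split=> [|x y]; first by rewrite (dehom_homogeneous (gr_deg1 S)); apply: mkfrac_eq.
have [m ->] := component_sum x; have [n ->] := component_sum y.
rewrite mulr_suml !raddf_sum mulr_suml; apply: eq_bigr => i _ /=.
rewrite mulr_sumr !raddf_sum mulr_sumr; apply: eq_bigr => j _ /=.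
have xi := component_deg x i; have yj := component_deg y j.
rewrite (dehom_homogeneous xi) (dehom_homogeneous yj) (dehom_homogeneous (gr_degM xi yj)).
by rewrite mkfracM (rees_mulh _ _ xi); apply: mkfrac_eq; rewrite exprD.
Qed.
HB.instance Definition _ := GRing.isMonoidMorphism.Build S Rg dehom dehom_monoid.

Local Notation G := (rees_gen Hg).
Local Notation psi := (to_image dehom).

Lemma rees_gen_deg : gr_deg S 1 G. Proof. exact: rees_mono_deg. Qed.

Lemma dehom_gen : dehom G = 1.
Proof.
rewrite (dehom_homogeneous rees_gen_deg) rees_monoE; apply: mkfrac_eq.
by rewrite expr1 mulr1 mul1r.
Qed.

(** An element of R[H/g] comes from a sum of components of degrees below n; multiplying the i-th one
    by [G ^+ (n - i)] makes the sum homogeneous with the same value. *)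
Lemma dehom_surj a : exists k x, gr_deg S k x /\ psi x = a.
Proof.
have [x <-] := to_image_surj a; have [n xE] := component_sum x.
pose y := \sum_(k < n) component x k * G ^+ (n - k).
have yn : gr_deg S n y.
  rewrite /y; elim/big_ind: _ => [|u v un vn|i _]; first exact: rees_deg0.
    by rewrite -[v]opprK; apply: gr_degB => //; exact: rees_degN.
  have := gr_degM (component_deg x i) (G_deg rees_gen_deg (n - i)).
  by rewrite subnKC // ltnW.
exists n, y; split=> //; apply: val_inj => /=; rewrite [in RHS]xE !raddf_sum.
apply: eq_bigr => i _ /=; by rewrite rmorphM rmorphXn /= dehom_gen expr1n mulr1.
Qed.

(** x_k/g^k vanishes in R_g exactly when some g^n x_k is zero, and this is the only coefficient of
    [G ^+ n * x] that can be nonzero. *)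
Lemma dehom_ker k x : gr_deg S k x -> psi x = 0 -> exists n, G ^+ n * x = 0.
Proof.
move=> xk /to_image_eq0; rewrite [LHS](dehom_homogeneous xk).
case/mkfracP => _ [n ->]; rewrite mul0r mulr1 mulr0 => e; exists n.
have Gx := gr_degM (G_deg rees_gen_deg n) xk.
apply: (rees_eqh Gx (rees_deg0 _)).
by rewrite (rees_mulh _ _ (G_deg rees_gen_deg n)) (rees_expE rees_gen_deg) rees_monoE rees0.
Qed.

Lemma in_ext_ideal_colon (I : set R) f : in_ext_ideal (blowup_mor H) I f ->
  exists m, idmul I (idpow H m) (f * g ^+ m).
Proof.
have psi1 : psi G = 1 by apply: val_inj; rewrite /= dehom_gen.
move=> /(in_ext_ideal_exp rees_gen_deg psi1 dehom_surj dehom_ker).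
by rewrite rees_monoE.
Qed.

End Dehomogenization.

Theorem proposition7p3p1 (R : comPzRingType) (Delta : set (set R))
    (I : set R) (f : R) :
  noetherian R ->
  (forall H : set R, Delta H -> is_ideal H) ->
  mult_closed Delta ->
  is_ideal I ->
  Delta_closure Delta I f <->
  exists H : set R, Delta H /\ in_ext_ideal (blowup_mor H) I f.
Proof.
move=> noethR idD multD idI; split=> [[H DH fH]|[H [DH fH]]].
  by exists H; split=> //; exact: colon_in_ext_ideal.
apply: (Delta_closure_fg noethR multD DH (idD H DH)) => g Hg.
exact: in_ext_ideal_colon fH.
Qed.
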